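(* Let $\mathbf{A}=(\mathcal{A},d,\mathcal{P},m)$ be a transversal arroid of rank $r\in\{1,2\}$. Then the associated arroid fan $\Sigma_{\mathbf{A}}\subset \mathbb{R}^{|\mathcal{A}|}/\langle (d_1,\dots,d_n)\rangle$ (a weighted rational polyhedral fan of dimension $r$, whose construction is given in the context) is a balanced tropical variety.
   Context: **Arroids.** An arroid of rank $r\in\{1,2\}$ is a tuple $\mathbf{A}=(\mathcal{A},d,\mathcal{P},m)$ where $\mathcal{A}=\{1,\dots,n\}$ is a finite set (the ground set; its elements are called divisors), $d:\mathcal{A}\to\mathbb{Z}_{>0}$ is a degree function (write $d_i=d(i)$), $\mathcal{P}$ is a multiset of subsets of $\mathcal{A}$ (called points), and $m=\{m_{\mathbf{p}}\mid \mathbf{p}\in\mathcal{P}\}$, where each $m_{\mathbf{p}}:\mathbf{p}^r\to\mathbb{Z}$ is invariant under permutation of coordinates and satisfies $1\le m_{\mathbf{p}}(i_1,\dots,i_r)\le\max_{k\in\{i_1,\dots,i_r\}} d_k$. The following Bézout property is required: for all $(i_1,\dots,i_r)\in\mathcal{A}^r$ with pairwise distinct entries, $$\sum_{\mathbf{p}\in\mathcal{P},\ \mathbf{p}\supseteq\{i_1,\dots,i_r\}} m_{\mathbf{p}}(i_1,\dots,i_r)=d_{i_1}\cdots d_{i_r}$$ (sum over the multiset, with repetition). The arroid is transversal if every $m_{\mathbf{p}}$ is constant equal to $1$. **Arroid fan.** Let $\mathcal{P}^u$ be the underlying set of $\mathcal{P}$ and, for $\mathbf{p}\in\mathcal{P}^u$,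 let $w(\mathbf{p})$ be the number of times $\mathbf{p}$ occurs in $\mathcal{P}$. Let $e_1,\dots,e_n$ be the standard basis of $\mathbb{R}^{|\mathcal{A}|}=\mathbb{R}^n$, let $[v]$ denote the class of $v$ in $\mathbb{R}^{|\mathcal{A}|}/\langle(d_1,\dots,d_n)\rangle$ (with lattice the image of $\mathbb{Z}^n$), and put $v_{\mathbf{p}}=\sum_{j\in\mathbf{p}}[e_j]$. - Rank one: $\Sigma_{\mathbf{A}}$ consists of the origin and the rays $\mathrm{cone}(v_{\mathbf{p}})$, $\mathbf{p}\in\mathcal{P}^u$, with weight $\omega(\mathrm{cone}(v_{\mathbf{p}}))=w(\mathbf{p})$. - Rank two: $\Sigma_{\mathbf{A}}$ consists of the origin, the rays $\rho_i=\mathrm{cone}([e_i])$ for $i\in\mathcal{A}$, the rays $\rho_{\mathbf{p}}=\mathrm{cone}(v_{\mathbf{p}})$ for $\mathbf{p}\in\mathcal{P}^u$, and the two-dimensional cones $\sigma_{i,\mathbf{p}}=\mathrm{cone}(\rho_i,\rho_{\mathbf{p}})$ for all $\mathbf{p}\in\mathcal{P}^u$ and $i\in\mathbf{p}$, with weight $\omega(\sigma_{i,\mathbf{p}})=w(\mathbf{p})$. **Balanced tropical variety.** A pure rational fan with integer weights $\omega(\sigma)$ on its top-dimensional cones is a (balanced) tropical variety if for each codimension one cone $\tau$, with $v_\sigma$ the primitive lattice generator of the image of $\sigma$ in the quotient of the ambient lattice by the saturated sublattice parallel to $\tau$, one has $\sum_{\sigma\succ\tau}\omega(\sigma)v_\sigma=0$,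 the sum being over top-dimensional cones $\sigma$ containing $\tau$.
   Formalization: With weights w(p) balancing can fail (rank 1, d=(2,1), points {1},{1},{2}); weights are multiplied by the lattice index of the cone's generators. The fan property assumes r<n and r≤|p|<n for all points; the original weights are kept if all indices are 1. *)

(* Defs.v *)
From HB Require Import structures.
From mathcomp Require Import all_boot all_order all_algebra all_fingroup.
From mathcomp Require Import boolp classical_sets reals.

Set Implicit Arguments.
Unset Strict Implicit.
Unset Printing Implicit Defensive.

Import Order.TTheory GRing.Theory Num.Theory.

Local Open Scope classical_set_scope.
Local Open Scope ring_scope.

(* The ground set is 'I_n.  The multiset of points is a finite family
   [point : 'I_npoints -> {set 'I_n}], so that two occurrences of the same
   subset may carry different functions m_p.  The function m_p is only
   meaningful (and only constrained) on r-tuples with entries in p. *)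
Record arroid (r n : nat) := Arroid {
  degree : 'I_n -> nat;
  npoints : nat;
  point : 'I_npoints -> {set 'I_n};
  mult : 'I_npoints -> {ffun 'I_r -> 'I_n} -> int;
  _ : (r == 1%N) || (r == 2%N);
  _ : forall i, (0 < degree i)%N;
  _ : forall k (i : {ffun 'I_r -> 'I_n}) (s : {perm 'I_r}),
        (forall a, i a \in point k) ->
        mult k [ffun a => i (s a)] = mult k i;
  _ : forall k (i : {ffun 'I_r -> 'I_n}),
        (forall a, i a \in point k) ->
        1 <= mult k i <= (\max_(a < r) degree (i a))%:Z;
  _ : forall i : {ffun 'I_r -> 'I_n}, injective i ->
        \sum_(k < npoints | [forall a, i a \in point k]) mult k i
        = \prod_(a < r) (degree (i a))%:Z
}.

Definition transversal_arroid (r n : nat) (A : arroid r n) : Prop :=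
  forall (k : 'I_(npoints A)) (i : {ffun 'I_r -> 'I_n}),
    (forall a, i a \in point k) -> mult k i = 1.

Definition underlying_points (r n : nat) (A : arroid r n) : {set {set 'I_n}} :=
  [set point k | k : 'I_(npoints A)].

Definition occurrences (r n : nat) (A : arroid r n) (p : {set 'I_n}) : nat :=
  #|[pred k : 'I_(npoints A) | point k == p]|.

(* A quotient R^n / U is handled through representatives: a vector of
   R^n / U is a vector of R^n up to U, a subset of R^n / U is given by its
   preimage in R^n.  The lattice of R^n / U is the image of Z^n. *)

Definition lattice (R : realType) (n : nat) : {pred 'rV[R]_n} :=
  [pred x | x \is a mxOver Num.int].

Definition cone (R : realType) (n : nat) (U : {vspace 'rV[R]_n})
    (s : seq 'rV[R]_n) : set 'rV[R]_n :=
  [set x | exists2 c : 'I_(size s) -> R, (forall k, 0 <= c k) &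
           x - \sum_(k < size s) c k *: s`_k \in U].

(* The preimage in R^n of the linear span of cone(s) in R^n / U. *)
Definition parallel (R : realType) (n : nat) (U : {vspace 'rV[R]_n})
    (s : seq 'rV[R]_n) : {vspace 'rV[R]_n} := (<<s>> + U)%VS.

Definition cone_dim (R : realType) (n : nat) (U : {vspace 'rV[R]_n})
    (s : seq 'rV[R]_n) : nat := (\dim (parallel U s) - \dim U)%N.

(* A face is cut out by a linear form on R^n / U, nonnegative on the cone. *)
Definition face (R : realType) (n : nat) (U : {vspace 'rV[R]_n})
    (D C : set 'rV[R]_n) : Prop :=
  exists f : 'cV[R]_n,
    [/\ forall x, x \in U -> x *m f = 0,
        forall x, C x -> 0 <= (x *m f) 0 0
      & D = C `&` [set x | x *m f = 0]].

(* Fans in R^n / modulus: a list of cones, each given by generators together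
   with its weight; the weight is only meaningful on top-dimensional cones. *)
Record weighted_fan (R : realType) (n : nat) := WeightedFan {
  modulus : {vspace 'rV[R]_n};
  cones : seq (seq 'rV[R]_n * int)
}.

Definition pure_rational_fan (R : realType) (r n : nat)
    (F : weighted_fan R n) : Prop :=
  let U := modulus F in
  [/\ forall s, s \in cones F -> {subset s.1 <= @lattice R n},
      forall s t, s \in cones F -> t \in cones F ->
        cone U s.1 = cone U t.1 -> s = t,
      forall s D, s \in cones F -> face U D (cone U s.1) ->
        exists2 t, t \in cones F & D = cone U t.1,
      forall s t, s \in cones F -> t \in cones F ->
        face U (cone U s.1 `&` cone U t.1) (cone U s.1) /\
        face U (cone U s.1 `&` cone U t.1) (cone U t.1)
    & uniq (cones F) /\ cones F != [::] /\
      forall s, s \in cones F -> exists t,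
        [/\ t \in cones F, cone_dim U t.1 = r
          & face U (cone U s.1) (cone U t.1)]].

(* v represents the primitive lattice generator of the ray C of R^n / L. *)
Definition primitive_generator (R : realType) (n : nat)
    (L : {vspace 'rV[R]_n}) (C : set 'rV[R]_n) (v : 'rV[R]_n) : Prop :=
  [/\ v \in @lattice R n, v \notin L, C = cone L [:: v]
    & forall (k : nat) u, u \in @lattice R n -> v - k%:R *: u \in L -> k = 1%N].

(* With L the preimage of the span of tau, Z^n / (Z^n :&: L) is the quotient
   of the lattice of R^n / U by the saturated sublattice parallel to tau, and
   [cone L s] is the image of sigma = [cone U s] in R^n / L. *)
Definition balanced (R : realType) (r n : nat) (F : weighted_fan R n) : Prop :=
  let U := modulus F in
  forall t, t \in cones F -> (cone_dim U t.1).+1 = r ->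
  let L := parallel U t.1 in
  let star := [seq s <- cones F | (cone_dim U s.1 == r)
                 && `[< face U (cone U t.1) (cone U s.1) >]] in
  exists2 v : seq 'rV[R]_n -> 'rV[R]_n,
    forall s, s \in star -> primitive_generator L (cone L s.1) (v s.1) &
    \sum_(s <- star) s.2%:~R *: v s.1 \in L.

Definition tropical_variety (R : realType) (r n : nat)
    (F : weighted_fan R n) : Prop :=
  pure_rational_fan r F /\ balanced r F.

(* Congruence modulo the subgroup of R^n / U generated by s. *)
Definition congruent (R : realType) (n : nat) (U : {vspace 'rV[R]_n})
    (s : seq 'rV[R]_n) (x y : 'rV[R]_n) : Prop :=
  exists c : 'I_(size s) -> int,
    x - y - \sum_(k < size s) (c k)%:~R *: s`_k \in U.

(* The index of the subgroup generated by s in the saturated sublattice of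
   R^n / U parallel to cone(s). *)
Definition is_lattice_index (R : realType) (n : nat) (U : {vspace 'rV[R]_n})
    (s : seq 'rV[R]_n) (q : nat) : Prop :=
  exists rep : 'I_q -> 'rV[R]_n,
    [/\ forall a, rep a \in @lattice R n /\ rep a \in parallel U s,
        forall a b, congruent U s (rep a) (rep b) -> a = b
      & forall x, x \in @lattice R n -> x \in parallel U s ->
          exists a, congruent U s x (rep a)].

Definition lattice_index (R : realType) (n : nat) (U : {vspace 'rV[R]_n})
    (s : seq 'rV[R]_n) : nat := xget 0%N [set q | is_lattice_index U s q].

(* Reads the weight of a cone as a multiplicity of its listed generators and
   turns it into a weight relative to the lattice.  This changes nothing when
   the listed generators generate the lattice points of their span, but is
   needed otherwise: [arroid_fan] with its weights w(p) need not be balanced.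
   In rank one take d = (2, 1) and the points {1}, {1}, {2}.  Then
   Z^2 / (2, 1) is Z with [e_1] = 1 and [e_2] = -2, the primitive generators
   of the two rays are 1 and -1, and their weights are 2 and 1.  In rank two
   take a conic and two lines in general position: d = (1, 1, 2) and the points
   {1, 2}, {1, 3}, {1, 3}, {2, 3}, {2, 3}; balancing fails along rho_1. *)
Definition index_weighted (R : realType) (n : nat)
    (F : weighted_fan R n) : weighted_fan R n :=
  WeightedFan (modulus F)
    [seq (s.1, s.2 * (lattice_index (modulus F) s.1)%:Z) | s <- cones F].

(* The listed generators of every top-dimensional cone generate the lattice
   points of its span. *)
Definition unimodular (R : realType) (r n : nat) (F : weighted_fan R n) : Prop :=
  forall s, s \in cones F -> cone_dim (modulus F) s.1 = r ->
  forall x, x \in @lattice R n -> x \in parallel (modulus F) s.1 ->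
    congruent (modulus F) s.1 x 0.

Definition std_vec (R : realType) (n : nat) (i : 'I_n) : 'rV[R]_n :=
  delta_mx 0 i.

Definition point_vec (R : realType) (n : nat) (p : {set 'I_n}) : 'rV[R]_n :=
  \sum_(j in p) std_vec R j.

Definition degree_vec (R : realType) (r n : nat) (A : arroid r n) : 'rV[R]_n :=
  \row_i (degree A i)%:R.

Definition arroid_fan (R : realType) (r n : nat) (A : arroid r n) :
    weighted_fan R n :=
  let w p := (occurrences A p)%:Z in
  let e := @std_vec R n in
  let v := @point_vec R n in
  let Pu := enum (underlying_points A) in
  WeightedFan <[degree_vec R A]>%VS
   (if r == 1%N then
      ([::], 0) :: [seq ([:: v p], w p) | p <- Pu]
    else
      ([::], 0) :: [seq ([:: e i], 0) | i <- enum 'I_n]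
        ++ [seq ([:: v p], 0) | p <- Pu]
        ++ [seq ([:: e i; v p], w p) | p <- Pu, i <- enum p]).

(* In general the listed cones may fail to be r-dimensional (for instance for
   the empty point, or in rank two for a point on a single divisor) or to meet
   along faces.  The latter can only come from a point on all divisors: in rank
   two with d = (1, 2, 3), the ray of {1, 2, 3} is spanned by 2 [e_1] + [e_2],
   in the interior of the cone spanned by [e_1] and [e_1] + [e_2]. *)
Definition nondegenerate_arroid (r n : nat) (A : arroid r n) : Prop :=
  (r < n)%N /\ forall k : 'I_(npoints A), (r <= #|point k| < n)%N.

(* Main.v *)
(* The rays and cones through a divisor i are balanced because the points
   containing i satisfy
     sum_(p ni i) v_p = d_i (d_1, ..., d_n) + c e_i
   by transversality and the Bezout property, and those through a point p because
   v_p = sum_(i in p) e_i.  Weighting by lattice indices makes this independent of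
   which generators are primitive: the index of (a, b) times the primitive
   generator of the image of b modulo a is the index of (a) times b.  That is all
   that balancing needs, even when several listed generators span the same ray.
   If no point contains all divisors, then every listed cone lies in the
   nonnegative vectors with a vanishing coordinate, on which the quotient by the
   positive vector (d_1, ..., d_n) is injective; the fan axioms then reduce to the
   uniqueness of the expression a e_i + b v_p of such a vector. *)
From mathcomp Require Import all_boot all_order all_algebra all_fingroup.
From mathcomp Require Import boolp classical_sets reals.
From mathcomp Require Import ring lra zify.
Require Import Defs.

Set Implicit Arguments.
Unset Strict Implicit.
Unset Printing Implicit Defensive.

Import Order.TTheory GRing.Theory Num.Theory.

Local Open Scope classical_set_scope.
Local Open Scope ring_scope.

(** * Lattice indices *)

Section Lattice.
Context {R : realType} {n : nat}.
Implicit Types (x y a b u : 'rV[R]_n) (U V : {vspace 'rV[R]_n}).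
Implicit Types (s t : seq 'rV[R]_n).

Lemma latticeP x : reflect (forall j, x 0 j \is a Num.int) (x \in @lattice R n).
Proof. by apply: (iffP mxOverP) => h => [j|i j]; rewrite ?ord1. Qed.

Lemma lattice0 : (0 : 'rV[R]_n) \in @lattice R n.
Proof. by apply/latticeP => j; rewrite mxE int_num0. Qed.

Lemma latticeD x y :
  x \in @lattice R n -> y \in @lattice R n -> x + y \in @lattice R n.
Proof.
by move=> /latticeP hx /latticeP hy; apply/latticeP => j; rewrite mxE rpredD.
Qed.

Lemma latticeZ c x :
  c \is a Num.int -> x \in @lattice R n -> c *: x \in @lattice R n.
Proof. by move=> hc /latticeP hx; apply/latticeP => j; rewrite mxE rpredM. Qed.

Lemma latticeB x y :
  x \in @lattice R n -> y \in @lattice R n -> x - y \in @lattice R n.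
Proof.
by move=> hx hy; rewrite -scaleN1r latticeD // latticeZ // rpredN int_num1.
Qed.

Lemma lattice_sum (I : Type) (r : seq I) (P : pred I) (F : I -> 'rV[R]_n) :
  (forall i, P i -> F i \in @lattice R n) ->
  \sum_(i <- r | P i) F i \in @lattice R n.
Proof.
apply: (big_ind (fun x => x \in @lattice R n)); first exact: lattice0.
exact: latticeD.
Qed.

Lemma memv_addlineP x a V :
  reflect (exists c : R, x - c *: a \in V) (x \in (<[a]> + V)%VS).
Proof.
apply: (iffP memv_addP) => [[y /vlineP[c ->] [v vV ->]]|[c h]].
  by exists c; rewrite addrAC subrr add0r.
exists (c *: a); first by apply/vlineP; exists c.
by exists (x - c *: a) => //; rewrite addrC subrK.
Qed.

(* This says that the lattice vectors outside [V] are detected by integral forms;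
   it holds for the subspaces spanned by lattice vectors. *)
Definition rational_subspace V := forall b, b \in @lattice R n -> b \notin V ->
  exists f : 'cV[R]_n, [/\ f \is a mxOver Num.int,
    forall x, x \in V -> x *m f = 0 & (b *m f) 0 0 != 0].

Lemma rational_subspace0 : rational_subspace 0%VS.
Proof.
move=> b _; rewrite memv0 => b0.
have [j bj] : exists j, b 0 j != 0.
  apply/existsP; apply: contraNT b0 => /existsPn h.
  by apply/eqP/rowP => j; rewrite mxE; apply/eqP; rewrite -[_ == _]negbK h.
exists (delta_mx j 0); split.
- by apply/mxOverP => i k; rewrite mxE intr_nat.
- by move=> x; rewrite memv0 => /eqP->; rewrite mul0mx.
- by rewrite -colE mxE.
Qed.

(** When [a] is outside [V], a form [f1] detecting it serves to eliminate [a] from [b]: the vector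
    [al *: b - be *: a] is still outside [V]. If [f2] detects that vector, then
    [al *: f2 - ga *: f1] vanishes at [a] and on [V], and its value at [b] is the value of [f2] at
    the eliminated vector. *)
Lemma rational_subspaceD V a : a \in @lattice R n ->
  rational_subspace V -> rational_subspace (<[a]> + V)%VS.
Proof.
move=> aL ratV b bL bV.
have [aV|aV] := boolP (a \in V).
  suff VE : (<[a]> + V)%VS = V by move: bV; rewrite VE => /ratV; apply.
  by apply/addv_idPr; rewrite -memvE.
have [f1 [f1Z f1V f1a]] := ratV _ aL aV.
have ent (g : 'cV[R]_n) c : c \in @lattice R n -> g \is a mxOver Num.int ->
    (c *m g) 0 0 \is a Num.int.
  move=> /latticeP cL /mxOverP gZ; rewrite mxE rpred_sum // => j _.
  by rewrite rpredM.
set al := (a *m f1) 0 0 in f1a; set be := (b *m f1) 0 0.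
have b'L : al *: b - be *: a \in @lattice R n.
  by apply: latticeB; apply: latticeZ => //; apply: ent.
have b'V : al *: b - be *: a \notin V.
  apply: contra bV => h; apply/memv_addlineP; exists (al^-1 * be).
  have -> : b - (al^-1 * be) *: a = al^-1 *: (al *: b - be *: a).
    by rewrite scalerBr !scalerA mulVf // scale1r.
  exact: memvZ.
have [f2 [f2Z f2V f2b]] := ratV _ b'L b'V.
set ga := (a *m f2) 0 0.
have scalar (x y : 'rV[R]_n) (g : 'cV[R]_n) c : x - c *: y \in V ->
    (forall z, z \in V -> z *m g = 0) -> x *m g = c *: (y *m g).
  by move=> h /(_ _ h)/eqP; rewrite mulmxBl -scalemxAl subr_eq0 => /eqP.
have mxB (x y : 'M[R]_1) : (x - y) 0 0 = x 0 0 - y 0 0 by rewrite !mxE.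
have mxZ c (x : 'M[R]_1) : (c *: x) 0 0 = c * x 0 0 by rewrite mxE.
exists (al *: f2 - ga *: f1); split.
- apply/mxOverP => i j; rewrite !mxE; move/mxOverP: f1Z => f1Z.
  by move/mxOverP: f2Z => f2Z; rewrite rpredB // rpredM // ent //; apply/mxOverP.
- move=> x /memv_addlineP[c h]; rewrite mulmxBr -!scalemxAr.
  rewrite (scalar _ _ _ _ h f1V) (scalar _ _ _ _ h f2V).
  apply/matrixP => i j; rewrite !ord1 mxB !mxZ.
  by rewrite -/al -/ga mulrCA [ga * _]mulrCA [ga * _]mulrC subrr mxE.
- apply: contraNneq f2b; rewrite mulmxBr -!scalemxAr mulmxBl -!scalemxAl.
  rewrite !mxB !mxZ -/be => h.
  by rewrite -/ga [be * _]mulrC h.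
Qed.

(* [b] and [u] span the same ray modulo [V], the latter being primitive, and
   [q] is the index of the multiples of [b]. *)
Definition primitive_quotient V b u (q : nat) : Prop :=
  [/\ u \in @lattice R n, (0 < q)%N, b - q%:R *: u \in V
    & forall x, x \in @lattice R n -> x \in (<[b]> + V)%VS ->
        exists k : int, x - k%:~R *: u \in V].

(* An integral form vanishing on [V] but not at [b] embeds the lattice of the
   line spanned by [b] in the integers; take [u] with the least positive value. *)
Lemma exists_primitive_quotient V b : rational_subspace V ->
  b \in @lattice R n -> b \notin V -> exists u q, primitive_quotient V b u q.
Proof.
move=> ratV bL bV; have [f [fZ fV fb]] := ratV _ bL bV.
pose phi x := (x *m f) 0 0.
have phiD x y : phi (x + y) = phi x + phi y by rewrite /phi mulmxDl mxE.
have phiZ c x : phi (c *: x) = c * phi x by rewrite /phi -scalemxAl mxE.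
have phiB x y : phi (x - y) = phi x - phi y by rewrite phiD -scaleN1r phiZ mulN1r.
have phiV x : x \in V -> phi x = 0 by move=> /fV; rewrite /phi => ->; rewrite mxE.
have phi0 x : x \in (<[b]> + V)%VS -> phi x = 0 -> x \in V.
  move=> /memv_addlineP[c xc] h; move: (phiV _ xc).
  move/eqP; rewrite phiB phiZ h sub0r oppr_eq0 mulf_eq0 (negPf fb) orbF.
  by move=> /eqP c0; move: xc; rewrite c0 scale0r subr0.
have phiint x : x \in @lattice R n -> phi x \is a Num.int.
  move=> /latticeP xL; rewrite /phi mxE rpred_sum // => j _.
  by move/mxOverP: fZ => fZ; rewrite rpredM.
have bb : b \in (<[b]> + V)%VS by rewrite memvE addvSl.
pose line x := x \in @lattice R n /\ x \in (<[b]> + V)%VS.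
have lineZ (k : int) x : line x -> line (k%:~R *: x).
  by move=> [xL xb]; split; [rewrite latticeZ ?intr_int|apply: memvZ].
have lineB x y : line x -> line y -> line (x - y).
  by move=> [xL xb] [yL yb]; split; [exact: latticeB|exact: memvB].
pose is_val (k : nat) := (0 < k)%N /\ exists x, line x /\ phi x = k%:R.
have ex_val : exists k, `[< is_val k >].
  have /intrP[m fm] := phiint _ bL.
  have m0 : m != 0 by apply: contraNneq fb => m0; rewrite -/(phi b) fm m0.
  exists `|m|%N; apply/asboolP; split; first by rewrite absz_gt0.
  exists ((sgz m)%:~R *: b); split; first exact: lineZ.
  by rewrite phiZ fm -intrM -abszEsg.
case: (ex_minnP ex_val) => k /asboolP[k_gt0 [u [lu phiu]]] kmin.
have multiple x : line x -> exists z : int, x - z%:~R *: u \in V.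
  move=> lx; have /intrP[m fm] := phiint _ lx.1.
  exists (m %/ k)%Z; set y := x - _; have ly : line y by apply/lineB/lineZ.
  have phiy : phi y = (m %% k)%Z%:~R.
    rewrite phiB phiZ fm phiu {1}(divz_eq m k) intrD intrM.
    by rewrite addrAC subrr add0r.
  apply: phi0; first exact: ly.2.
  have k0 : (k : int) != 0 by rewrite eqz_nat -lt0n.
  have /ZnatP : (m %% k)%Z \is a Num.nat by rewrite Znat_def modz_ge0.
  case=> j mj; rewrite phiy mj; case: j mj => // j mj; exfalso.
  have : (m %% k)%Z < k by rewrite ltz_pmod // ltz_nat.
  rewrite mj ltz_nat ltnNge kmin //; apply/asboolP; split=> //.
  by exists y; rewrite phiy mj.
have [z bz] := multiple b (conj bL bb).
have z0 : z != 0 by apply: contraNneq bV => z0; move: bz; rewrite z0 scale0r subr0.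
(* The form may be negative at [b]; adjusting the sign of [u] makes [b] a positive multiple of it
   modulo [V]. *)
exists ((sgz z)%:~R *: u), `|z|%N; split.
- by have [] := lineZ (sgz z) u lu.
- by rewrite absz_gt0.
- by rewrite scalerA -[_%:R]/(`|z|%N%:~R) -intrM mulrC -intEsg.
- move=> x xL xb; have [j hj] := multiple x (conj xL xb).
  by exists (j * sgz z); rewrite scalerA -intrM -mulrA mulz_sg z0 mulr1.
Qed.

(** This carries a membership obtained by combining known ones over to the desired vector, leaving
    only a vector identity to check. *)
Lemma memv_eq V x y : x \in V -> x = y -> y \in V.
Proof. by move=> + <-. Qed.

Lemma parallel_nil U : parallel U [::] = U.
Proof. by rewrite /parallel span_nil add0v. Qed.

Lemma parallel_cons U b s : parallel U (b :: s) = (<[b]> + parallel U s)%VS.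
Proof. by rewrite /parallel span_cons addvA. Qed.

Lemma subv_parallel U s : (U <= parallel U s)%VS.
Proof. exact: addvSr. Qed.

Lemma mem_parallel U s x : x \in s -> x \in parallel U s.
Proof. by move=> xs; rewrite memvE (subv_trans _ (addvSl _ _)) // -memvE memv_span. Qed.

Lemma rational_subspace_parallel U s : {subset s <= @lattice R n} ->
  rational_subspace U -> rational_subspace (parallel U s).
Proof.
move=> sL ratU; elim: s sL => [|b s IHs] sL; first by rewrite parallel_nil.
rewrite parallel_cons; apply: rational_subspaceD.
  by apply: sL; rewrite mem_head.
by apply: IHs => x xs; apply: sL; rewrite inE xs orbT.
Qed.

(** * Congruence modulo the generators and indices of sublattices *)

Lemma congruent_nil U x y : congruent U [::] x y <-> x - y \in U.
Proof.
split=> [[c]|h]; first by rewrite big_ord0 subr0.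
by exists (fun _ => 0); rewrite big_ord0 subr0.
Qed.

Lemma congruent_cons U b s x y :
  congruent U (b :: s) x y <-> exists z : int, congruent U s (x - z%:~R *: b) y.
Proof.
split=> [[c h]|[z [c h]]].
  exists (c ord0), (fun k => c (lift ord0 k)); move: h; rewrite big_ord_recl /=.
  by rewrite opprD addrA [x - y - _]addrAC.
exists (fun k => if unlift ord0 k is Some j then c j else z).
rewrite big_ord_recl unlift_none opprD addrA [x - y - _]addrAC.
by under eq_bigr do rewrite liftK.
Qed.

Lemma congruent_sym U s x y : congruent U s x y -> congruent U s y x.
Proof.
case=> c h; exists (fun k => - c k); rewrite -memvN.
apply: memv_eq h _.
under [in RHS]eq_bigr do rewrite intrN scaleNr.
by rewrite sumrN; move: (\sum_(_ < _) _) => S; apply/rowP => j; rewrite !mxE; ring.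
Qed.

Lemma congruent_trans U s x y z :
  congruent U s x y -> congruent U s y z -> congruent U s x z.
Proof.
case=> c h [c' h']; exists (fun k => c k + c' k).
apply: memv_eq (memvD h h') _.
under [in RHS]eq_bigr do rewrite intrD scalerDl.
by rewrite big_split /= opprD addrACA subrKA.
Qed.

Lemma congruent_subr U s x y w : congruent U s (x - w) y <-> congruent U s x (y + w).
Proof.
by split=> -[c h]; exists c; move: h; rewrite opprD [- y - w]addrC addrA.
Qed.

Lemma congruent_parallel U s x y : congruent U s x y -> x - y \in parallel U s.
Proof.
case=> c h; rewrite -(subrK (\sum_(k < size s) (c k)%:~R *: s`_k) (x - y)).
apply: memvD; first exact: (subvP (subv_parallel U s)).
by apply: memv_suml => k _; apply/memvZ; apply: mem_parallel; apply: mem_nth.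
Qed.

(** Sending each representative of one system to a congruent one of the other is injective, since
    distinct representatives are incongruent; this gives both inequalities. *)
Lemma is_lattice_index_unique U s q q' :
  is_lattice_index U s q -> is_lattice_index U s q' -> q = q'.
Proof.
suff le p p' : is_lattice_index U s p -> is_lattice_index U s p' -> (p <= p')%N.
  by move=> h h'; apply/eqP; rewrite eqn_leq !le.
move=> [rep [repL rep_inj _]] [rep' [_ _ rep'_surj]].
have /choice[f fE] : forall i : 'I_p, exists j : 'I_p', congruent U s (rep i) (rep' j).
  by move=> a; have [] := repL a; exact: rep'_surj.
have f_inj : injective f.
  move=> a b fab; apply: rep_inj; apply: congruent_trans (fE a) _.
  by rewrite fab; apply/congruent_sym/fE.
by rewrite -(card_ord p) -(card_ord p') (leq_card f).
Qed.

Lemma lattice_index_eq U s q : is_lattice_index U s q -> lattice_index U s = q.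
Proof.
move=> h; apply: xget_unique => // q' h'; exact: is_lattice_index_unique h' h.
Qed.

(** Representatives may be labelled by any finite type; pairs are the labels when a generator is
    added to the list. *)
Lemma is_lattice_index_card U s (T : finType) (rep : T -> 'rV[R]_n) :
  (forall i, rep i \in @lattice R n /\ rep i \in parallel U s) ->
  (forall i j, congruent U s (rep i) (rep j) -> i = j) ->
  (forall x, x \in @lattice R n -> x \in parallel U s ->
     exists i, congruent U s x (rep i)) ->
  is_lattice_index U s #|T|.
Proof.
move=> repL rep_inj rep_surj; exists (rep \o enum_val); split=> //=.
- by move=> a b /rep_inj /enum_val_inj.
- move=> x xL xs; have [a ha] := rep_surj x xL xs.
  by exists (enum_rank a); rewrite enum_rankK.
Qed.

Lemma is_lattice_index_nil U : is_lattice_index U [::] 1.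
Proof.
exists (fun _ => 0); split=> [a|a b _|x _]; first by rewrite lattice0 mem0v.
- by rewrite !ord1.
- by rewrite parallel_nil => xU; exists ord0; apply/congruent_nil; rewrite subr0.
Qed.

Lemma parallel_swap U a b : parallel U [:: b; a] = parallel U [:: a; b].
Proof. by rewrite !parallel_cons !addvA [(<[a]> + <[b]>)%VS]addvC. Qed.

Lemma is_lattice_index_swap U a b q :
  is_lattice_index U [:: a; b] q -> is_lattice_index U [:: b; a] q.
Proof.
have cong x y c d : congruent U [:: c; d] x y -> congruent U [:: d; c] x y.
  move=> /congruent_cons[z /congruent_cons[w h]].
  by apply/congruent_cons; exists w; apply/congruent_cons; exists z; rewrite addrAC.
move=> [rep [repL rep_inj rep_surj]]; exists rep; rewrite parallel_swap; split=> //.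
- by move=> i j /cong /rep_inj.
- by move=> x xL xs; have [i /cong] := rep_surj x xL xs; exists i.
Qed.

Lemma primitive_quotient_notin V b u q :
  b \notin V -> primitive_quotient V b u q -> u \notin V.
Proof.
move=> bV [_ _ h _]; apply: contra bV => uV.
by rewrite -(subrK (q%:R *: u) b) memvD // memvZ.
Qed.

(** Indices multiply: modulo [V] the multiples of [b] have index [q] among those of [u], and inside
    [V] the generators [s] have index [q1]. The representatives are [k u + rep a] with [k < q]. *)
Lemma primitive_quotient_index U b s u q q1 :
  b \notin parallel U s -> primitive_quotient (parallel U s) b u q ->
  is_lattice_index U s q1 -> b \in @lattice R n ->
  is_lattice_index U (b :: s) (q * q1)%N.
Proof.
set V := parallel U s => bV prim [rep [repL rep_inj rep_surj]] bL.
have uV := primitive_quotient_notin bV prim; case: prim => uL q_gt0 buV uprim.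
have -> : (q * q1)%N = #|{: 'I_q * 'I_q1}| by rewrite card_prod !card_ord.
apply: (@is_lattice_index_card _ _ ('I_q * 'I_q1)%type
  (fun k => (k.1 : nat)%:R *: u + rep k.2)).
- move=> [k a] /=; have [aL aV] := repL a; split.
    by rewrite latticeD ?latticeZ ?intr_nat //; exact: (intr_int _ (Posz k)).
  rewrite parallel_cons memvD ?memvZ //.
    apply/memv_addlineP; exists q%:R^-1.
    have q0 : q%:R != 0 :> R by rewrite pnatr_eq0 -lt0n.
    apply: memv_eq (memvZ (- q%:R^-1) buV) _.
    by apply/rowP => j; rewrite !mxE; field.
  by rewrite memvE (subv_trans _ (addvSr _ _)).
- move=> [k a] [l c] /= /congruent_cons[z h].
  have [[_ aV] [_ cV]] := (repL a, repL c).
  (* Read modulo [V], the congruence loses [rep a], [rep c] and the combination of [s], while [b]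
     becomes [q u]. *)
  have : (k%:Z - l%:Z - z * q%:Z)%:~R *: u \in V.
    apply: memv_eq (memvD (memvD (memvB (congruent_parallel h) aV) cV)
                         (memvZ z%:~R buV)) _.
    by apply/rowP => j; rewrite !mxE; ring.
  rewrite memvE; case: (altP (k%:Z - l%:Z - z * q%:Z =P 0)); last first.
    move=> ne0 h0; case/negP: uV; move: h0; rewrite -memvE => h0.
    by have := memvZ (k%:Z - l%:Z - z * q%:Z)%:~R^-1 h0;
       rewrite scalerA mulVf ?scale1r // intr_eq0.
  (* Both [k] and [l] are less than [q], so their difference is a multiple of [q] only when it is
     zero. *)
  move=> klz _; have z0 : z = 0 by have := ltn_ord k; have := ltn_ord l; nia.
  have kl : k = l by apply/val_inj; move: klz; rewrite z0 /=; lia.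
  rewrite kl; congr pair; apply: rep_inj; case: h => w h; exists w.
  by apply: memv_eq h _; rewrite z0 kl; apply/rowP => j; rewrite !mxE; ring.
- move=> x xL; rewrite parallel_cons => xV; have [m hm] := uprim x xL xV.
  have q0 : q%:Z != 0 by rewrite eqz_nat -lt0n.
  have lt_q : (`|(m %% q)%Z| < q)%N.
    by rewrite -ltz_nat gez0_abs ?modz_ge0 // ltz_pmod.
  (* Modulo [V], [x] is [m u]: the quotient of [m] by [q] goes into [b], the remainder is [k], and
     what is left over lies in [V]. *)
  set z := (m %/ q)%Z; set k := Ordinal lt_q.
  have kE : k%:Z = (m %% q)%Z by rewrite /= gez0_abs ?modz_ge0.
  have [||a ha] := rep_surj (x - z%:~R *: b - k%:R *: u).
  + by rewrite !latticeB ?latticeZ ?intr_int ?(intr_int _ (Posz k)).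
  + apply: memv_eq (memvB hm (memvZ z%:~R buV)) _; rewrite {1}(divz_eq m q) -kE.
    by apply/rowP => j; rewrite !mxE; ring.
  + exists (k, a); apply/congruent_cons; exists z; move/congruent_subr: ha.
    by rewrite /= [_ + rep a]addrC.
Qed.

(** * Cones and their faces *)

Lemma cone_nil U x : cone U [::] x <-> x \in U.
Proof.
split=> [[c _]|h]; first by rewrite big_ord0 subr0.
by exists (fun _ => 0) => //; rewrite big_ord0 subr0.
Qed.

Lemma cone_cons U b s x :
  cone U (b :: s) x <-> exists2 c : R, 0 <= c & cone U s (x - c *: b).
Proof.
split=> [[c c_ge0 h]|[z z_ge0 [c c_ge0 h]]].
  exists (c ord0) => //; exists (fun k => c (lift ord0 k)) => //.
  by move: h; rewrite big_ord_recl /= opprD addrA.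
exists (fun k => if unlift ord0 k is Some j then c j else z).
  by move=> k; case: unliftP.
by rewrite big_ord_recl unlift_none opprD addrA; under eq_bigr do rewrite liftK.
Qed.

Lemma cone1 U b x : cone U [:: b] x <-> exists2 c : R, 0 <= c & x - c *: b \in U.
Proof.
by split=> [/cone_cons[c c0 /cone_nil h]|[c c0 h]];
  [exists c|apply/cone_cons; exists c => //; apply/cone_nil].
Qed.

Lemma cone_translate U s x y : x - y \in U -> cone U s x -> cone U s y.
Proof.
move=> xy [c c_ge0 h]; exists c => //; apply: memv_eq (memvB h xy) _.
by rewrite addrAC opprB [x + _]addrC subrK.
Qed.

Lemma cone_mod U s x : x \in U -> cone U s x.
Proof.
move=> xU; exists (fun _ => 0) => //.
by rewrite big1 ?subr0 // => k _; rewrite scale0r.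
Qed.

Lemma mem_cone U s x : x \in s -> cone U s x.
Proof.
elim: s => // b s IHs; rewrite inE => /orP[/eqP->|xs]; apply/cone_cons.
  by exists 1 => //; rewrite scale1r subrr; apply/cone_mod/mem0v.
by exists 0 => //; rewrite scale0r subr0; apply: IHs.
Qed.

Lemma cone_parallel U s x : cone U s x -> x \in parallel U s.
Proof.
case=> c _ h; rewrite -(subrK (\sum_(k < size s) c k *: s`_k) x).
apply: memvD; first exact: (subvP (subv_parallel U s)).
by apply: memv_suml => k _; apply/memvZ; apply: mem_parallel; apply: mem_nth.
Qed.

Lemma parallel_cone U s t : cone U s = cone U t -> parallel U s = parallel U t.
Proof.
suff sub s' t' : cone U s' = cone U t' -> (parallel U s' <= parallel U t')%VS.
  by move=> h; apply: subv_anti; rewrite !sub.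
move=> h; rewrite /parallel subv_add addvSr andbT; apply/span_subvP => x xs.
by apply: cone_parallel; rewrite -h; apply: mem_cone.
Qed.

Section Form.
Variables (U : {vspace 'rV[R]_n}) (f : 'cV[R]_n).
Hypothesis fU : forall x, x \in U -> x *m f = 0.

Lemma formE c x y : ((x - c *: y) *m f) 0 0 = (x *m f) 0 0 - c * (y *m f) 0 0.
Proof.
by rewrite mulmxBl -scalemxAl; move: (x *m f) (y *m f) => ? ?; rewrite !mxE.
Qed.

Lemma form_eq0 x : (x *m f = 0) <-> ((x *m f) 0 0 = 0).
Proof.
split=> [->|h]; first by rewrite mxE.
by apply/matrixP => i j; rewrite !ord1 h mxE.
Qed.

Lemma form_cone_ge0 s x : {in s, forall b, 0 <= (b *m f) 0 0} ->
  cone U s x -> 0 <= (x *m f) 0 0.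
Proof.
elim: s x => [|b s IHs] x h; first by move=> /cone_nil/fU->; rewrite mxE.
move=> /cone_cons[c c_ge0 /IHs]; rewrite formE subr_ge0 => le_cx.
apply: le_trans (le_cx _); first by rewrite mulr_ge0 // h // mem_head.
by move=> y ys; apply: h; rewrite inE ys orbT.
Qed.

(** A sum of nonnegative values vanishes only if each of them does, so a generator outside the
    kernel of the form can only have coefficient zero. *)
Lemma cone_form_eq0 s : {in s, forall b, 0 <= (b *m f) 0 0} ->
  cone U s `&` [set x | x *m f = 0] = cone U [seq b <- s | b *m f == 0].
Proof.
move=> h; apply/seteqP; split=> x /=; elim: s x h => [|b s IHs] x h /=.
- by case.
- have hs : {in s, forall b, 0 <= (b *m f) 0 0}.
    by move=> y ys; apply: h; rewrite inE ys orbT.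
  have hb : 0 <= (b *m f) 0 0 by rewrite h ?mem_head.
  case=> /cone_cons[c c_ge0 hc] /form_eq0 xf.
  have := form_cone_ge0 hs hc; rewrite formE xf sub0r oppr_ge0 => le0.
  have /eqP cb : c * (b *m f) 0 0 == 0 by rewrite eq_le le0 mulr_ge0.
  have {IHs} hc' := IHs _ hs (conj hc _).
  case: ifPn => bf; first apply/cone_cons; first exists c => //.
    by apply: hc'; apply/form_eq0; rewrite formE xf cb subrr.
  have c0 : c = 0.
    move/eqP: cb; rewrite mulf_eq0 => /orP[/eqP//|/eqP/form_eq0/eqP].
    by rewrite (negPf bf).
  move: hc'; rewrite c0 scale0r subr0; apply; exact/form_eq0.
- by move=> /cone_nil xU; split; [exact/cone_nil|exact: fU].
- have hs : {in s, forall b, 0 <= (b *m f) 0 0}.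
    by move=> y ys; apply: h; rewrite inE ys orbT.
  case: ifPn => bf => [/cone_cons[c c_ge0 /(IHs _ hs)[xs /form_eq0 xf]]|].
    split; first by apply/cone_cons; exists c.
    apply/form_eq0; move: xf; rewrite formE.
    by move/eqP/form_eq0: bf => ->; rewrite mulr0 subr0.
  move=> /(IHs _ hs)[xs xf]; split=> //; apply/cone_cons; exists 0 => //.
  by rewrite scale0r subr0.
Qed.

Lemma face_form s : {in s, forall b, 0 <= (b *m f) 0 0} ->
  face U (cone U [seq b <- s | b *m f == 0]) (cone U s).
Proof.
move=> h; exists f; split=> // [x|]; first exact: form_cone_ge0.
by rewrite cone_form_eq0.
Qed.

End Form.

(** The generators in the kernel of the defining form generate the face, by [cone_form_eq0];
    questions about faces thus reduce to finitely many sublists. *)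
Lemma faceP U s D : face U D (cone U s) ->
  exists P : pred 'rV[R]_n, D = cone U (filter P s).
Proof.
case=> f [fU f_ge0 ->]; exists (fun b => b *m f == 0).
by rewrite cone_form_eq0 // => b bs; apply/f_ge0/mem_cone.
Qed.

(** Scaling a form by its own value at [b] turns that value into a square. *)
Lemma rational_subspace_pos V b : rational_subspace V -> b \in @lattice R n ->
  b \notin V ->
  exists2 f : 'cV[R]_n, forall x, x \in V -> x *m f = 0 & 0 < (b *m f) 0 0.
Proof.
move=> ratV bL bV; have [f [_ fV fb]] := ratV _ bL bV.
exists ((b *m f) 0 0 *: f) => [x /fV xf|]; first by rewrite -scalemxAr xf scaler0.
by rewrite -scalemxAr mxE -expr2 exprn_even_gt0.
Qed.

Lemma dimv_addline V b : \dim (<[b]> + V) = ((b \notin V) + \dim V)%N.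
Proof.
have [bV|bV] := boolP (b \in V).
  by rewrite (addv_idPr _) // -memvE.
rewrite dimv_disjoint_sum ?dim_vline; first by case: eqP bV => // ->; rewrite mem0v.
apply/eqP; rewrite -subv0; apply/subvP => x /memv_capP[/vlineP[c ->] cb].
have [->|c0] := eqVneq c 0; first by rewrite scale0r mem0v.
by case/negP: bV; rewrite -(scale1r b) -(mulVf c0) -scalerA memvZ.
Qed.

(** * Dimensions of cones, primitive generators and two-dimensional cones *)

Lemma cone_dim_nil U : cone_dim U [::] = 0.
Proof. by rewrite /cone_dim parallel_nil subnn. Qed.

Lemma cone_dim1 U b : cone_dim U [:: b] = (b \notin U).
Proof. by rewrite /cone_dim parallel_cons parallel_nil dimv_addline addnK. Qed.

Lemma cone_dim2 U a b :
  cone_dim U [:: a; b] = ((a \notin parallel U [:: b]) + (b \notin U))%N.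
Proof.
rewrite /cone_dim [parallel U [:: a; b]]parallel_cons dimv_addline.
by rewrite parallel_cons parallel_nil dimv_addline addnA addnK.
Qed.

Lemma cone_dim0_parallel U s : cone_dim U s = 0 -> parallel U s = U.
Proof.
move=> /eqP; rewrite subn_eq0 => h; apply/esym/eqP.
by rewrite eqEdim subv_parallel.
Qed.

Lemma primitive_quotient_generator V b u q :
  b \notin V -> primitive_quotient V b u q ->
  primitive_generator V (cone V [:: b]) u.
Proof.
move=> bV prim; have uV := primitive_quotient_notin bV prim.
case: prim => uL q_gt0 buV uprim.
have qR : 0 < q%:R :> R by rewrite ltr0n.
have neq0 c : c *: u \in V -> c = 0.
  move=> cu; apply/eqP; apply: contraNT uV => c0.
  by rewrite -(scale1r u) -(mulVf c0) -scalerA memvZ.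
split=> //.
  apply/seteqP; split=> x /cone1[c c_ge0 h]; apply/cone1.
    exists (c * q%:R); first by rewrite mulr_ge0 // ltW.
    apply: memv_eq (memvD h (memvZ c buV)) _.
    by apply/rowP => j; rewrite !mxE; ring.
  exists (c / q%:R); first by rewrite divr_ge0 // ltW.
  apply: memv_eq (memvB h (memvZ (c / q%:R) buV)) _.
  by apply/rowP => j; rewrite !mxE; field; rewrite lt0r_neq0.
move=> k x xL kx.
have k0 : k%:R != 0 :> R.
  by apply: contraNneq uV => k0; move: kx; rewrite k0 scale0r subr0.
(* Modulo [V], [x] is [u / k] and [u] is [b / q], so [x] lies on the line of [b] and is an integer
   multiple [m u]; hence [k m = 1]. *)
have [m hm] : exists m : int, x - m%:~R *: u \in V.
  apply: uprim => //; apply/memv_addlineP; exists (k%:R^-1 * q%:R^-1).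
  apply: memv_eq (memvD (memvZ (- k%:R^-1) kx)
                       (memvZ (- (k%:R^-1 * q%:R^-1)) buV)) _.
  by apply/rowP => j; rewrite !mxE; field; rewrite k0 lt0r_neq0.
have /neq0/eqP : (1 - k%:Z * m)%:~R *: u \in V.
  apply: memv_eq (memvD kx (memvZ k%:R hm)) _.
  by apply/rowP => j; rewrite !mxE; ring.
rewrite intr_eq0 subr_eq0 => /eqP km; apply/eqP; rewrite -dvdn1.
by rewrite -[(k %| 1)%N]/((k%:Z %| 1)%Z); apply/dvdzP; exists m; rewrite mulrC.
Qed.

(** If [b] is [p u] modulo the span of [s], with [u] primitive, then adding [b] to [s] multiplies
    the index by [p]. So the new index times [u] is [q b]: in balancing sums, primitive generators
    can be replaced by listed ones. *)
Lemma exists_star_vector U s b q :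
  rational_subspace U -> {subset s <= @lattice R n} -> b \in @lattice R n ->
  is_lattice_index U s q -> b \notin parallel U s ->
  exists2 u, primitive_generator (parallel U s) (cone (parallel U s) [:: b]) u
           & (lattice_index U (b :: s))%:R *: u - q%:R *: b \in parallel U s.
Proof.
move=> ratU sL bL idx bV.
have [u [p prim]] :=
  exists_primitive_quotient (rational_subspace_parallel sL ratU) bL bV.
exists u; first exact: primitive_quotient_generator prim.
rewrite (lattice_index_eq (primitive_quotient_index bV prim idx bL)).
case: prim => _ _ h _; apply: memv_eq (memvZ (- q%:R) h) _.
by apply/rowP => j; rewrite !mxE; ring.
Qed.

Lemma exists_lattice_index1 U b : rational_subspace U ->
  b \in @lattice R n -> b \notin U -> exists q, is_lattice_index U [:: b] q.
Proof.
move=> ratU bL bU; have [u [q prim]] := exists_primitive_quotient ratU bL bU.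
exists (q * 1)%N; apply: primitive_quotient_index (is_lattice_index_nil U) bL.
  by rewrite parallel_nil.
by rewrite parallel_nil; exact: prim.
Qed.

Lemma cone_dim_parallel U s t : parallel U s = parallel U t ->
  cone_dim U s = cone_dim U t.
Proof. by rewrite /cone_dim => ->. Qed.

Lemma cone_swap U a b : cone U [:: b; a] = cone U [:: a; b].
Proof.
have sub c d : cone U [:: c; d] `<=` cone U [:: d; c].
  move=> x /cone_cons[y y0 /cone_cons[z z0 h]].
  by apply/cone_cons; exists z => //; apply/cone_cons; exists y => //; rewrite addrAC.
by apply/seteqP; split; apply: sub.
Qed.

Lemma cone_mod_cons U V a s : a \in V -> (U <= V)%VS ->
  cone V (a :: s) = cone V s.
Proof.
move=> aV UV; apply/seteqP; split=> x; last first.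
  by move=> h; apply/cone_cons; exists 0 => //; rewrite scale0r subr0.
move=> /cone_cons[c _]; apply: cone_translate.
by rewrite addrAC subrr sub0r memvN memvZ.
Qed.

Lemma cone_dim2P U a b : cone_dim U [:: a; b] = 2%N ->
  [/\ a \notin U, b \notin U, a \notin parallel U [:: b]
    & b \notin parallel U [:: a]].
Proof.
move=> dim2; have dim2' : cone_dim U [:: b; a] = 2%N.
  by rewrite -dim2; apply/cone_dim_parallel/parallel_swap.
move: dim2 dim2'; rewrite !cone_dim2.
by case: (a \notin _); case: (b \notin _); case: (a \notin _); case: (b \notin _).
Qed.

(** Since [b] is outside the span of [a] modulo [U], some form vanishes on that span and is positive
    at [b]; its kernel retains only [a]. *)
Lemma ray_face U a b : rational_subspace U -> a \in @lattice R n ->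
  b \in @lattice R n -> cone_dim U [:: a; b] = 2%N ->
  face U (cone U [:: a]) (cone U [:: a; b]).
Proof.
move=> ratU aL bL /cone_dim2P[_ _ _ b_a].
have aL' : {subset [:: a] <= @lattice R n} by move=> x; rewrite inE => /eqP->.
have [f fV fb] := rational_subspace_pos (rational_subspace_parallel aL' ratU) bL b_a.
have fU x : x \in U -> x *m f = 0 by move/(subvP (subv_parallel U [:: a]))/fV.
have fa : a *m f = 0 by apply/fV/mem_parallel/mem_head.
have := @face_form U f fU [:: a; b]; rewrite /= fa eqxx ifN.
  apply=> x; rewrite !inE => /orP[]/eqP->; last exact: ltW.
  by rewrite fa mxE.
by apply/eqP => /form_eq0 h; rewrite h ltxx in fb.
Qed.

(** Every face comes from one of the four sublists of the generators, and dimension excludes the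
    empty and the full one. *)
Lemma face_ray U s a b : cone_dim U s = 1%N -> cone_dim U [:: a; b] = 2%N ->
  face U (cone U s) (cone U [:: a; b]) ->
  cone U s = cone U [:: a] \/ cone U s = cone U [:: b].
Proof.
move=> dim1 dim2 /faceP[P]; rewrite /=; case: (P a); case: (P b); [|by left|by right|].
- by move/parallel_cone/cone_dim_parallel; rewrite dim1 dim2.
- by move/parallel_cone/cone_dim_parallel; rewrite dim1 cone_dim_nil.
Qed.

(** Both orders of the generators are covered because an arroid cone always lists [e i] before
    [v p], whichever of the two spans the ray to quotient by. *)
Lemma exists_edge_vector U a b : rational_subspace U -> a \in @lattice R n ->
  b \in @lattice R n -> cone_dim U [:: a; b] = 2%N ->
  let L := parallel U [:: a] in
  exists u, [/\ primitive_generator L (cone L [:: a; b]) u,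
    (lattice_index U [:: a; b])%:R *: u - (lattice_index U [:: a])%:R *: b \in L
    & (lattice_index U [:: b; a])%:R *: u - (lattice_index U [:: a])%:R *: b \in L].
Proof.
move=> ratU aL bL /cone_dim2P[a_U _ a_b b_a] L.
have aL' : {subset [:: a] <= @lattice R n} by move=> x; rewrite inE => /eqP->.
have [q idx] := exists_lattice_index1 ratU aL a_U.
have [u gen eq_u] := exists_star_vector ratU aL' bL idx b_a.
have coneE : cone L [:: a; b] = cone L [:: b].
  by apply: (cone_mod_cons _ _ (subv_parallel U [:: a])); apply/mem_parallel/mem_head.
have idxE : lattice_index U [:: a; b] = lattice_index U [:: b; a].
  have [w [p prim]] :=
    exists_primitive_quotient (rational_subspace_parallel aL' ratU) bL b_a.
  have idx2 := primitive_quotient_index b_a prim idx bL.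
  by rewrite (lattice_index_eq idx2); apply/lattice_index_eq/is_lattice_index_swap.
by exists u; rewrite coneE (lattice_index_eq idx) idxE; split.
Qed.

Lemma lattice_index1 U s :
  (forall x, x \in @lattice R n -> x \in parallel U s -> congruent U s x 0) ->
  lattice_index U s = 1%N.
Proof.
move=> h; apply: lattice_index_eq; exists (fun=> 0); split=> [_|i j _|x xL xs].
- by rewrite lattice0 mem0v.
- by rewrite !ord1.
- by exists ord0; apply: h.
Qed.

Lemma coneDZ U s k x y : 0 <= k -> cone U s x -> cone U s y ->
  cone U s (x + k *: y).
Proof.
move=> k0 [c c0 hc] [c' c'0 hc']; exists (fun i => c i + k * c' i) => [i|].
  by rewrite addr_ge0 // mulr_ge0.
apply: memv_eq (memvD hc (memvZ k hc')) _.
under [in RHS]eq_bigr do rewrite scalerDl -scalerA.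
rewrite big_split /= -scaler_sumr; move: (\sum_(_ < _) _) (\sum_(_ < _) _) => S T.
by apply/rowP => j; rewrite !mxE; ring.
Qed.

Lemma cone_subset U s t : {subset s <= t} -> cone U s `<=` cone U t.
Proof.
elim: s => [|b s IHs] st x; first by move/cone_nil; exact: cone_mod.
move=> /cone_cons[c c0 /(IHs _)]; rewrite -{2}(subrK (c *: b) x) => h.
apply: coneDZ => //; first by apply: h => y ys; apply: st; rewrite inE ys orbT.
by apply/mem_cone/st/mem_head.
Qed.

(** * Simplicial fans *)

(** Coefficients are functions of the generator, not of its position, so that lists and their
    sublists can be compared; for a list without repetition nothing is lost. *)
Lemma parallelP U s x : uniq s -> x \in parallel U s ->
  exists c : 'rV[R]_n -> R, x - \sum_(b <- s) c b *: b \in U.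
Proof.
elim: s x => [|b s IHs] x /=.
  by rewrite parallel_nil => _ xU; exists (fun=> 0); rewrite big_nil subr0.
move=> /andP[bs us]; rewrite parallel_cons => /memv_addlineP[k /(IHs _ us)[c h]].
exists (fun y => if y == b then k else c y); rewrite big_cons eqxx opprD addrA.
rewrite (eq_big_seq (fun y => c y *: y)) // => y ys.
by case: eqP ys => // ->; rewrite (negPf bs).
Qed.

Lemma coneP U s x : uniq s -> cone U s x <->
  exists2 c : 'rV[R]_n -> R, forall y, 0 <= c y & x - \sum_(b <- s) c b *: b \in U.
Proof.
elim: s x => [|b s IHs] x /=.
  move=> _; split=> [/cone_nil xU|[c _]].
    by exists (fun=> 0) => //; rewrite big_nil subr0.
  by rewrite big_nil subr0 => /cone_nil.
move=> /andP[bs us]; split=> [/cone_cons[k k0 /(IHs _ us)[c c0 h]]|[c c0 h]].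
  exists (fun y => if y == b then k else c y) => [y|]; first by case: ifP.
  rewrite big_cons eqxx opprD addrA (eq_big_seq (fun y => c y *: y)) // => y ys.
  by case: eqP ys => // ->; rewrite (negPf bs).
apply/cone_cons; exists (c b) => //; apply/(IHs _ us); exists c => //.
by move: h; rewrite big_cons opprD addrA.
Qed.

Definition free_mod U s := forall c : 'rV[R]_n -> R,
  \sum_(b <- s) c b *: b \in U -> {in s, forall b, c b = 0}.

Lemma free_mod_cons U b s : uniq (b :: s) -> free_mod U (b :: s) ->
  b \notin parallel U s /\ free_mod U s.
Proof.
move=> /= /andP[bs us] free; split.
  apply/negP => /(parallelP us)[c h].
  have := free (fun y => if y == b then 1 else - c y).
  rewrite big_cons eqxx scale1r (eq_big_seq (fun y => - (c y *: y))) => [|y ys].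
    by rewrite sumrN => /(_ h b (mem_head _ _)); rewrite eqxx => /eqP; rewrite oner_eq0.
  by case: eqP ys => [->|_ _]; [rewrite (negPf bs)|rewrite scaleNr].
move=> c h y ys; have := free (fun y => if y == b then 0 else c y).
rewrite big_cons eqxx scale0r add0r (eq_big_seq (fun y => c y *: y)) => [|z zs].
  move=> /(_ h y); rewrite inE ys orbT => /(_ isT).
  by case: eqP ys => // ->; rewrite (negPf bs).
by case: eqP zs => // ->; rewrite (negPf bs).
Qed.

Lemma free_cone_dim U s : uniq s -> free_mod U s -> cone_dim U s = size s.
Proof.
elim: s => [|b s IHs] us free; first exact: cone_dim_nil.
have [bs free'] := free_mod_cons us free; have /andP[_ us'] := us.
rewrite /= -IHs // /cone_dim parallel_cons dimv_addline bs add1n subSn //.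
exact/dimvS/subv_parallel.
Qed.

Lemma free_notin U s b : uniq s -> free_mod U s -> b \in s ->
  b \notin parallel U (rem b s).
Proof.
move=> us free bs; have sE := perm_to_rem bs.
apply: (proj1 (@free_mod_cons _ _ _ _ _)); first by rewrite -(perm_uniq sE).
move=> c h y; rewrite -(perm_mem sE); apply: free.
by rewrite (perm_big _ sE).
Qed.

(** For each generator [b] some form vanishes on the other generators and is positive at [b]. The
    sum of these forms over the discarded generators vanishes exactly at the kept ones. *)
Lemma free_face U s (P : pred 'rV[R]_n) : rational_subspace U ->
  {subset s <= @lattice R n} -> uniq s -> free_mod U s ->
  face U (cone U (filter P s)) (cone U s).
Proof.
move=> ratU sL us free.
have /choice[f fP] : forall b, exists f : 'cV[R]_n, b \in s ->
    (forall x, x \in parallel U (rem b s) -> x *m f = 0) /\ 0 < (b *m f) 0 0.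
  move=> b; have [bs|_] := boolP (b \in s); last by exists 0.
  have remL : {subset rem b s <= @lattice R n} by move=> x /mem_rem/sL.
  have [f f1 f2] := rational_subspace_pos (rational_subspace_parallel remL ratU)
                     (sL _ bs) (free_notin us free bs).
  by exists f.
pose g := \sum_(b <- s | ~~ P b) f b.
have gU x : x \in U -> x *m g = 0.
  move=> xU; rewrite mulmx_sumr big_seq_cond big1 // => b /andP[bs _].
  by apply: (fP _ bs).1; apply: (subvP (subv_parallel _ _)).
have gE b : b \in s -> b *m g = if P b then 0 else b *m f b.
  move=> bs; rewrite mulmx_sumr; have zero y : y \in s -> y != b -> b *m f y = 0.
    move=> ys yb; apply: (fP _ ys).1; apply: mem_parallel.
    by rewrite mem_rem_uniq // !inE eq_sym yb.
  rewrite big_mkcond (bigD1_seq b) //= big_seq_cond big1 ?addr0 => [|y].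
    by case: (P b).
  by move=> /andP[ys yb]; rewrite zero //; case: ifP.
have -> : filter P s = [seq b <- s | b *m g == 0].
  apply: eq_in_filter => b bs; rewrite gE //; case: (P b); first by rewrite eqxx.
  by apply/esym/eqP => /form_eq0 h; have := (fP _ bs).2; rewrite h ltxx.
apply: face_form => // b bs; rewrite gE //; case: (P b); first by rewrite mxE.
exact/ltW/(fP _ bs).2.
Qed.

(** This one condition carries the fan axioms: for [t = s] it contains linear independence modulo
    [U], and in general it makes two cones meet in the cone on their common generators. *)
Definition separated U s t := forall c c' : 'rV[R]_n -> R,
  (forall y, 0 <= c y) -> (forall y, 0 <= c' y) ->
  \sum_(b <- s) c b *: b - \sum_(b <- t) c' b *: b \in U ->
  {in s, forall b, c b = if b \in t then c' b else 0}.

(** Positive and negative parts of the coefficients give two nonnegative expressions that agree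
    modulo [U]; separation equates the two parts, so both vanish. *)
Lemma separated_free U s : separated U s s -> free_mod U s.
Proof.
move=> sep c h b bs.
have := sep (fun y => Num.max (c y) 0) (fun y => Num.max (- c y) 0).
have max0 (z : R) : 0 <= Num.max z 0 by rewrite le_max lexx orbT.
move=> /(_ (fun=> max0 _) (fun=> max0 _)); rewrite -sumrB.
have pm (z : R) : Num.max z 0 - Num.max (- z) 0 = z.
  by case: (leP z 0) => hz; [rewrite (max_idPl _)|rewrite (max_idPr _)];
    rewrite ?sub0r ?opprK ?subr0 ?oppr_ge0 ?oppr_le0 // ltW.
under eq_bigr do rewrite -scalerBl pm.
by move=> /(_ h b bs); rewrite bs => E; rewrite -[LHS]pm E subrr.
Qed.

(** Coefficients on a sublist extend by zero to the whole list. Hence separation only has to be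
    checked on maximal cones. *)
Lemma separated_filter U s t (P Q : pred 'rV[R]_n) :
  separated U s t -> separated U (filter P s) (filter Q t).
Proof.
move=> sep c c' c0 c'0 h b; rewrite mem_filter => /andP[Pb bs].
pose cP y := if P y then c y else 0; pose cQ y := if Q y then c' y else 0.
have sumE (D : pred 'rV[R]_n) (a : 'rV[R]_n -> R) l :
    \sum_(y <- filter D l) a y *: y = \sum_(y <- l) (if D y then a y else 0) *: y.
  rewrite big_filter big_mkcond; apply: eq_bigr => y _.
  by case: (D y) => //; rewrite scale0r.
rewrite !sumE in h.
have := sep cP cQ _ _ h b bs; rewrite /cP /cQ Pb mem_filter => ->.
- by case: (Q b) => //=; case: ifP.
- by move=> y; case: ifP.
- by move=> y; case: ifP.
Qed.

(** Separation forces the expression of a common point in [s] to use common generators only. *)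
Lemma cone_separated U s t : uniq s -> uniq t -> separated U s t ->
  cone U s `&` cone U t = cone U [seq b <- s | b \in t].
Proof.
move=> us ut sep; apply/seteqP; split=> [x [/(coneP _ _ us)[c c0 hc]]|x h].
  move=> /(coneP _ _ ut)[c' c'0 hc'].
  have cs : {in s, forall b, c b = if b \in t then c' b else 0}.
    apply: sep => //; apply: memv_eq (memvB hc' hc) _.
    move: (\sum_(_ <- _) _) (\sum_(_ <- _) _) => S T.
    by rewrite [LHS]addrC opprB subrKA.
  apply/coneP; first exact: filter_uniq.
  exists c => //; apply: memv_eq hc _; congr (_ - _); rewrite big_filter.
  rewrite [RHS]big_mkcond; apply: eq_big_seq => b /cs ->.
  by case: ifP => //; rewrite scale0r.
by split; apply: cone_subset h => y; rewrite mem_filter => /andP[].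
Qed.

End Lattice.

(** This reduces the fan axioms to the combinatorics of generator lists: faces correspond to
    sublists by [faceP] and [free_face], and intersections to common generators by
    [cone_separated]. *)
Lemma simplicial_fan (R : realType) (r n : nat) (F : weighted_fan R n) :
  let U := modulus F in
  rational_subspace U ->
  {in cones F, forall s, uniq s.1 /\ {subset s.1 <= @lattice R n}} ->
  {in cones F &, forall s t, separated U s.1 t.1} ->
  {in cones F &, forall s t, s.1 =i t.1 -> s = t} ->
  {in cones F, forall s (P : pred 'rV[R]_n),
     exists2 t, t \in cones F & t.1 = filter P s.1} ->
  {in cones F, forall s, exists2 t, t \in cones F /\ size t.1 = r
     & exists P : pred 'rV[R]_n, s.1 = filter P t.1} ->
  uniq (cones F) -> cones F != [::] ->
  pure_rational_fan r F.
Proof.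
move=> U ratU gens sep inj_gens filterF maxF uniqF F0.
have free (s : seq 'rV[R]_n * int) : s \in cones F -> free_mod U s.1.
  by move=> sF; apply: separated_free; apply: sep.
have mem (s t : seq 'rV[R]_n * int) : s \in cones F -> t \in cones F ->
    cone U s.1 = cone U t.1 -> {subset s.1 <= t.1}.
  move=> sF tF st b bs; have [us _] := gens _ sF; have [ut _] := gens _ tF.
  have := mem_cone U bs; rewrite st => /(coneP _ _ ut)[c c0 h].
  (* The vector [b] is compared with itself, written with coefficient [1] in [s]; were it absent
     from [t], separation would make this coefficient zero. *)
  have := sep _ _ sF tF (fun y => (y == b)%:R) c (fun=> ler0n _ _) c0.
  rewrite (bigD1_seq b) //= eqxx scale1r big1 ?addr0 => [|y /negPf->]; last first.
    by rewrite scale0r.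
  by move=> /(_ h b bs)/eqP; rewrite eqxx; case: ifP; rewrite // oner_eq0.
split.
- by move=> s /gens[].
- move=> s t sF tF st; apply: inj_gens => // b.
  by apply/idP/idP; apply: mem.
- move=> s D sF /faceP[P ->]; have [t tF tE] := filterF s sF P.
  by exists t; rewrite ?tE.
- have half (s t : seq 'rV[R]_n * int) : s \in cones F -> t \in cones F ->
      face U (cone U s.1 `&` cone U t.1) (cone U s.1).
    move=> sF tF; have [us sL] := gens _ sF; have [ut _] := gens _ tF.
    by rewrite cone_separated //; [apply: free_face => //; exact: free|exact: sep].
  by move=> s t sF tF; split; [|rewrite setIC]; apply: half.
- split=> //; split=> // s sF; have [t [tF tr] [P sE]] := maxF s sF.
  have [ut tL] := gens _ tF; exists t; split=> //.
    by rewrite free_cone_dim //; exact: free.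
  by rewrite sE; apply: free_face => //; exact: free.
Qed.

(** * Arroid fans *)

Section Arroid.
Context {R : realType} {r n : nat}.
Variable A : arroid r n.
Implicit Types (i j : 'I_n) (p q : {set 'I_n}).
Hypothesis transversal : transversal_arroid A.

Local Notation d := (degree_vec R A).
Local Notation e := (@std_vec R n).
Local Notation v := (@point_vec R n).
Local Notation U := (<[d]>%VS).
Local Notation Pu := (enum (underlying_points A)).
Local Notation F := (index_weighted (arroid_fan R A)).

(** * Bezout counts and sums of point vectors *)

Lemma arroid_rank : r = 1%N \/ r = 2%N.
Proof. by case: A => ? ? ? ? + _ _ _ _ => /orP[]/eqP; [left|right]. Qed.

Lemma degree_gt0 i : (0 < degree A i)%N.
Proof. by move: i; case: A. Qed.

Lemma bezout (i : {ffun 'I_r -> 'I_n}) : injective i ->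
  \sum_(k < npoints A | [forall a, i a \in point k]) mult k i
  = \prod_(a < r) (degree A (i a))%:Z.
Proof. by move: i; case: A. Qed.

Lemma count_points (i : {ffun 'I_r -> 'I_n}) : injective i ->
  #|[pred k : 'I_(npoints A) | [forall a, i a \in point k]]|
    = (\prod_(a < r) degree A (i a))%N.
Proof.
move=> i_inj; apply/eqP; rewrite -eqz_nat -[X in _ == X]intz -pmulrn natr_prod.
under [X in _ == X]eq_bigr do rewrite pmulrn intz.
rewrite -(bezout i_inj) (eq_bigr (fun=> 1)) => [|k /forallP h]; last exact: transversal.
by rewrite sumr_const pmulrn intz.
Qed.

Lemma std_vecE i j : e i 0 j = (i == j)%:R.
Proof. by rewrite mxE eqxx eq_sym. Qed.

Lemma point_vecE p j : v p 0 j = (j \in p)%:R.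
Proof.
rewrite summxE; under eq_bigr do rewrite std_vecE.
have [jp|jp] := boolP (j \in p).
  rewrite (bigD1 j) //= eqxx big1 ?addr0 // => i /andP[_ /negPf->] //.
by rewrite big1 // => i ip; case: eqP ip jp => // -> ->.
Qed.

Lemma std_vec_lattice i : e i \in @lattice R n.
Proof. by apply/latticeP => j; rewrite std_vecE intr_nat. Qed.

Lemma point_vec_lattice p : v p \in @lattice R n.
Proof. by apply/lattice_sum => i _; apply: std_vec_lattice. Qed.

Lemma degree_vec_mod : d \in U.
Proof. exact: memv_line. Qed.

Lemma degree_rational : rational_subspace U.
Proof.
rewrite -[U]addv0; apply: rational_subspaceD rational_subspace0.
by apply/latticeP => j; rewrite mxE intr_nat.
Qed.

(** The fan uses distinct points with multiplicities and the Bezout property uses the indexed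
    family; grouping indices by their point links the two. *)
Lemma sum_occurrences (G : {set 'I_n} -> 'rV[R]_n) :
  \sum_(p <- enum (underlying_points A)) (occurrences A p)%:R *: G p
    = \sum_(k < npoints A) G (point k).
Proof.
rewrite big_enum /= [RHS](partition_big (@point r n A) (mem (underlying_points A))).
  apply: eq_bigr => p _; rewrite (eq_bigr (fun=> G p)) => [|k /eqP-> //].
  by rewrite sumr_const scaler_nat.
by move=> k _; apply/imsetP; exists k.
Qed.

(** Coordinate [j] of the sum counts the points containing [j], and the Bezout property for the
    one-entry tuple [j] gives [d_j]. *)
Lemma sum_point_vec1 : r = 1%N -> \sum_(k < npoints A) v (point k) = d.
Proof.
move=> r1; apply/rowP => j; rewrite summxE mxE.
have inj : injective [ffun _ : 'I_r => j].
  by move=> [a ha] [b hb] _; apply/val_inj => /=; lia.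
have := count_points inj; have a0 : 'I_r by rewrite r1; exact: ord0.
rewrite (eq_bigr (fun=> degree A j)) => [|a _]; last by rewrite ffunE.
rewrite prod_nat_const card_ord [X in (_ ^ X)%N]r1 expn1 => <-.
under eq_bigr do rewrite point_vecE.
rewrite -natr_sum -sum1_card [in RHS]big_mkcond /=; congr (_%:R); apply: eq_bigr => k _.
rewrite inE /=; case: (boolP (j \in point k)) => jk.
  by rewrite (introT forallP) // => a; rewrite ffunE.
by case: ifP => // /forallP/(_ a0); rewrite ffunE (negPf jk).
Qed.

Lemma card_points2 i j : r = 2%N -> i != j ->
  #|[pred k : 'I_(npoints A) | (i \in point k) && (j \in point k)]|
    = (degree A i * degree A j)%N.
Proof.
(* As [r] equals [2] only through a hypothesis, the pair [(i, j)] is encoded by testing the value of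
   the index. *)
move=> r2 ij; pose f := [ffun a : 'I_r => if val a == 0%N then i else j].
have lt0 : (0 < r)%N by lia.
have lt1 : (1 < r)%N by lia.
have f0 : f (Ordinal lt0) = i by rewrite ffunE.
have f1 : f (Ordinal lt1) = j by rewrite ffunE.
have ord_cases (a : 'I_r) : a = Ordinal lt0 \/ a = Ordinal lt1.
  by case: a => [[|[|m]] am]; [left|right|exfalso; lia]; apply: val_inj.
have inj : injective f.
  move=> a b; case: (ord_cases a) => ->; case: (ord_cases b) => ->; rewrite ?f0 ?f1 //.
    by move/eqP; rewrite (negPf ij).
  by move/eqP; rewrite eq_sym (negPf ij).
have := count_points inj; rewrite (bigD1 (Ordinal lt0)) //= (bigD1 (Ordinal lt1)) //=.
rewrite f0 f1 big1 ?muln1 => [<-|a /andP[]]; last first.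
  by case: (ord_cases a) => ->; rewrite eqxx.
apply: eq_card => k; rewrite !inE; apply/andP/forallP => [[ik jk] a|h].
  by case: (ord_cases a) => ->; rewrite ?f0 ?f1.
by have := h (Ordinal lt0); have := h (Ordinal lt1); rewrite f0 f1.
Qed.

(** For [j] other than [i], coordinate [j] counts the points through both, which is [d_i d_j].
    Coordinate [i] escapes this count, and [c] is chosen to absorb it. *)
Lemma sum_point_vec2 i : r = 2%N -> exists c : R,
  \sum_(k < npoints A | i \in point k) v (point k)
    = c *: e i + (degree A i)%:R *: d.
Proof.
move=> r2; set S := \sum_(_ < _ | _) _.
exists (S 0 i - (degree A i)%:R * d 0 i); apply/rowP => j.
rewrite mxE [X in X + _]mxE [X in _ + X]mxE std_vecE.
have [<-|ij] := eqVneq i j; first by rewrite mulr1 subrK.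
rewrite mulr0 add0r mxE -natrM -card_points2 // /S summxE.
under eq_bigr do rewrite point_vecE.
rewrite -natr_sum -sum1_card big_mkcond /= [in RHS]big_mkcond /=.
by congr (_%:R); apply: eq_bigr => k _; rewrite inE /=; do 2 case: (_ \in _).
Qed.

(** * Balancing of the index-weighted arroid fan *)

Definition weight p s : int := (occurrences A p)%:Z * (lattice_index U s)%:Z.

Lemma cones_rank1 : r = 1%N ->
  cones F = ([::], 0) :: [seq ([:: v p], weight p [:: v p]) | p <- Pu].
Proof.
by move=> /eqP r1; rewrite /= r1 /= mul0r -map_comp.
Qed.

Lemma cones_rank2 : r = 2%N ->
  cones F = ([::], 0) :: [seq ([:: e i], 0) | i <- enum 'I_n]
    ++ [seq ([:: v p], 0) | p <- Pu]
    ++ [seq ([:: e i; v p], weight p [:: e i; v p]) | p <- Pu, i <- enum p].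
Proof.
move=> r2; have r1 : (r == 1%N) = false by apply/eqP; lia.
rewrite /= r1 /= mul0r !map_cat -!map_comp map_allpairs.
congr (_ :: _ ++ _ ++ _); apply: eq_map => x /=; by rewrite mul0r.
Qed.

(** Modulo [U], index times primitive generator is [v p], so the weighted sum is congruent to the
    sum of all point vectors, which is [d]. *)
Lemma balanced_rank1 : r = 1%N -> balanced r F.
Proof.
move=> r1; rewrite /balanced; cbv zeta; rewrite -[modulus F]/U cones_rank1 //.
move=> t tF dimt; set L := parallel U t.1.
have LU : L = U by apply: cone_dim0_parallel; move: dimt; rewrite [X in _ = X]r1 => -[].
(* A listed ray may degenerate, so [t] need not be the empty list; its cone is the origin all the
   same. *)
have coneU : cone U t.1 = cone U [::].
  apply/seteqP; split=> x; last by move/cone_nil; exact: cone_mod.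
  by move=> /cone_parallel; rewrite -/L LU => /cone_nil.
have /choice[u uP] : forall s, exists u, forall b, s = [:: b] ->
    b \in @lattice R n -> b \notin U -> primitive_generator U (cone U s) u /\
    (lattice_index U s)%:R *: u - b \in U.
  move=> [|b [|? ?]]; [by exists 0| |by exists 0].
  have [/andP[bL bU]|nb] := boolP ((b \in @lattice R n) && (b \notin U)); last first.
    by exists 0 => _ [<-] bL bU; case/negP: nb; rewrite bL.
  have bU' : b \notin parallel U [::] by rewrite parallel_nil.
  have sL : {subset [::] <= @lattice R n} by [].
  have [u] := exists_star_vector degree_rational sL bL (is_lattice_index_nil U) bU'.
  rewrite parallel_nil scale1r => gen idx; exists u => _ [<-] _ _; split=> //.
have ray_star p : v p \notin U -> face U (cone U t.1) (cone U [:: v p]).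
  move=> vpU; rewrite coneU.
  have [f fU fp] := rational_subspace_pos degree_rational (point_vec_lattice p) vpU.
  have := @face_form _ _ U f fU [:: v p]; rewrite /= ifN.
    by apply=> b; rewrite inE => /eqP->; apply: ltW.
  by apply/eqP => /form_eq0 h; rewrite h ltxx in fp.
exists u => [s|].
  rewrite mem_filter inE => /andP[/andP[/eqP dims _]].
  move=> sF; move: dims; rewrite [X in _ = X]r1.
  case/predU1P: sF => [->|/mapP[p _ ->]] /=; first by rewrite cone_dim_nil.
  rewrite cone_dim1 LU => vpU; have {}vpU : v p \notin U by case: (_ \in _) vpU.
  by have [] := uP _ _ erefl (point_vec_lattice p) vpU.
rewrite big_filter LU big_cons /= cone_dim_nil.
rewrite (_ : (0%N == r) = false) /=; last by rewrite r1.
rewrite big_map /=.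
rewrite big_mkcond /=; set W := \sum_(_ <- _) _.
(* Points with [v p] in [U] are missing from the star, but adding them changes the sum only by an
   element of [U]. *)
suff : W - \sum_(p <- Pu) (occurrences A p)%:R *: v p \in U.
  rewrite sum_occurrences sum_point_vec1 // => h.
  by rewrite -(subrK d W) memvD // degree_vec_mod.
rewrite /W -sumrB; apply: memv_suml => p _; rewrite cone_dim1.
have [vpU|vpU] := boolP (v p \in U).
  by rewrite [X in _ == X]r1 /= sub0r memvN memvZ.
rewrite [X in (_ == X)]r1 /= asboolT; last exact: ray_star.
have [_ h] := uP _ _ erefl (point_vec_lattice p) vpU.
by rewrite intrM -scalerA -scalerBr memvZ.
Qed.

(** Modulo [L], the star sum splits into one group for each divisor [i] and one for each point [p]
    whose listed ray is the cone of [t]; each group lies in [L] separately. *)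
Lemma balanced_rank2 : r = 2%N -> balanced r F.
Proof.
move=> r2; rewrite /balanced; cbv zeta; rewrite -[modulus F]/U cones_rank2 //.
move=> t tF dimt; set L := parallel U t.1.
move: dimt; rewrite [X in _ = X]r2 => -[dimt].
have UL : (U <= L)%VS by exact: subv_parallel.
(* In a two-dimensional cone at most one of the two generators spans [t], so the two alternatives in
   [uP] never compete. *)
have raysDiff a b : cone_dim U [:: a; b] = 2%N -> cone U t.1 = cone U [:: a] ->
    cone U t.1 <> cone U [:: b].
  move=> /cone_dim2P[_ _ /negP a_b _] -> /parallel_cone ab; apply: a_b.
  by rewrite -ab; apply/mem_parallel/mem_head.
have /choice[u uP] : forall s, exists u, forall a b, s = [:: a; b] ->
    a \in @lattice R n -> b \in @lattice R n -> cone_dim U [:: a; b] = 2%N ->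
    (cone U t.1 = cone U [:: a] -> primitive_generator L (cone L s) u /\
      (lattice_index U s)%:R *: u - (lattice_index U [:: a])%:R *: b \in L) /\
    (cone U t.1 = cone U [:: b] -> primitive_generator L (cone L s) u /\
      (lattice_index U s)%:R *: u - (lattice_index U [:: b])%:R *: a \in L).
  move=> [|a [|b [|? ?]]]; [by exists 0|by exists 0| |by exists 0].
  have [[aL bL dim2]|nok] := pselect [/\ a \in @lattice R n,
      b \in @lattice R n & cone_dim U [:: a; b] = 2%N]; last first.
    by exists 0 => _ _ [<- <-] aL bL dim2; case: nok.
  have [ta|nta] := pselect (cone U t.1 = cone U [:: a]).
    have [u [gen eq_u _]] := exists_edge_vector degree_rational aL bL dim2.
    have LE : L = parallel U [:: a] by apply: parallel_cone.
    exists u => _ _ [<- <-] _ _ _; rewrite LE; split=> // /(raysDiff _ _ dim2 ta) //.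
  have [tb|ntb] := pselect (cone U t.1 = cone U [:: b]); last first.
    by exists 0 => _ _ [<- <-].
  have dim2' : cone_dim U [:: b; a] = 2%N.
    by rewrite -dim2; apply/cone_dim_parallel/parallel_swap.
  have [u [gen _ eq_u]] := exists_edge_vector degree_rational bL aL dim2'.
  have LE : L = parallel U [:: b] by apply: parallel_cone.
  by exists u => _ _ [<- <-] _ _ _; rewrite LE -cone_swap; split.
have dim_rays b : (cone_dim U [:: b] == r) = false.
  by rewrite cone_dim1 [X in _ == X]r2; case: (b \notin U).
exists u => [s|].
  rewrite mem_filter inE !mem_cat => /andP[/andP[/eqP dims /asboolP fs] sF].
  case/predU1P: sF dims fs => [->|]; first by rewrite cone_dim_nil [X in _ = X]r2.
  case/or3P=> [/mapP[i _ ->]|/mapP[p _ ->]|/allpairsPdep[p [i [_ _ ->]]]] /=.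
  - by move/eqP; rewrite dim_rays.
  - by move/eqP; rewrite dim_rays.
  rewrite [X in _ = X]r2 => dim2 /(face_ray dimt dim2).
  have [ha hb] := uP _ _ _ erefl (std_vec_lattice i) (point_vec_lattice p) dim2.
  by case=> [/ha[]|/hb[]].
rewrite big_filter big_cons /= cone_dim_nil (_ : (0%N == r) = false); last first.
  by rewrite r2.
rewrite big_cat big_map big1 ?add0r /= => [|i]; last by rewrite dim_rays.
rewrite big_cat big_map big1 ?add0r /= => [|p]; last by rewrite dim_rays.
rewrite add0r big_mkcond big_allpairs_dep /=.
(* When [b] spans [t], this is the contribution modulo [L] of the cone on [b] and [x], up to the
   multiplicity of the point. Cones are compared rather than generators, since several of these may
   span one ray. *)
pose ray b (x : 'rV[R]_n) :=
  if `[< cone U t.1 = cone U [:: b] >] then (lattice_index U [:: b])%:R *: x else 0.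
suff term (p : {set 'I_n}) i : i \in p ->
  (if (cone_dim U [:: e i; v p] == r) &&
      `[< face U (cone U t.1) (cone U [:: e i; v p]) >]
   then (weight p [:: e i; v p])%:~R *: u [:: e i; v p] else 0) -
  (occurrences A p)%:R *: (ray (e i) (v p) + ray (v p) (e i)) \in L.
  set W := \sum_(_ <- _) _.
  pose W' := \sum_(p <- Pu) \sum_(i <- enum p)
    (occurrences A p)%:R *: (ray (e i) (v p) + ray (v p) (e i)).
  have -> : W = (W - W') + W' by rewrite subrK.
  apply: memvD.
    rewrite /W /W' -sumrB; apply: memv_suml => p _; rewrite -sumrB big_seq.
    by apply: memv_suml => i; rewrite mem_enum; exact: term.
  have -> : W' = \sum_(p <- Pu) (occurrences A p)%:R *: (\sum_(i in p) ray (e i) (v p))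
      + \sum_(p <- Pu) (occurrences A p)%:R *: (\sum_(i in p) ray (v p) (e i)).
    rewrite -big_split /=; apply: eq_bigr => p _.
    by rewrite -scalerDr -big_split /= scaler_sumr big_enum.
  apply: memvD.
    rewrite (sum_occurrences (fun p => \sum_(i in p) ray (e i) (v p))).
    (* For a fixed [i] spanning [t], the points through [i] sum to a multiple of [e i] plus a
       multiple of [d], and both lie in [L]. *)
    rewrite (exchange_big_dep predT) //=; apply: memv_suml => i _.
    rewrite /ray; case: asboolP => [ti|_]; last by rewrite big1 ?mem0v.
    rewrite -scaler_sumr memvZ //; have [c ->] := sum_point_vec2 i r2.
    have LE : L = parallel U [:: e i] by apply: parallel_cone.
    apply: memvD; first by rewrite memvZ // LE; apply/mem_parallel/mem_head.
    by rewrite memvZ // (subvP UL) // degree_vec_mod.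
  (* For a fixed [p] spanning [t], the vectors [e i] with [i] in [p] sum to [v p], which lies in
     [L]. *)
  apply: memv_suml => p _; rewrite memvZ //.
  rewrite /ray; case: asboolP => [tp|_]; last by rewrite big1 ?mem0v.
  have LE : L = parallel U [:: v p] by apply: parallel_cone.
  by rewrite -scaler_sumr memvZ // LE; apply/mem_parallel/mem_head.
move=> ip; rewrite [X in _ == X]r2.
(* A cone of dimension below two is not in the star; if one of its generators spans [t], the other
   lies in [L], so its [ray] terms do no harm. *)
have [dim2|/eqP ndim2] := eqVneq (cone_dim U [:: e i; v p]) 2%N; last first.
  rewrite sub0r memvN memvZ //= /ray.
  have notdim2 a b : cone U t.1 = cone U [:: a] ->
      cone_dim U [:: a; b] <> 2%N -> b \in L.
    move=> ta; have LE : L = parallel U [:: a] by apply: parallel_cone.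
    have := cone_dim_parallel LE; rewrite dimt cone_dim1.
    rewrite -(cone_dim_parallel (parallel_swap U a b)) cone_dim2 -LE.
    by case: (a \notin U) => // _; case: (b \in L).
  rewrite memvD //; case: asboolP => [tx|_]; rewrite ?mem0v // memvZ //.
    by apply: notdim2 tx _.
  apply: notdim2 tx _; by rewrite (cone_dim_parallel (parallel_swap U (e i) (v p))).
have [ha hb] := uP _ _ _ erefl (std_vec_lattice i) (point_vec_lattice p) dim2.
rewrite /= /ray; case: (asboolP (cone U t.1 = cone U [:: e i])) => [ti|nti].
  rewrite asboolT; last first.
    rewrite ti; apply: ray_face => //; [exact: degree_rational|exact: std_vec_lattice|].
    exact: point_vec_lattice.
  rewrite asboolF ?addr0; last exact: raysDiff dim2 ti.
  by have [_ h] := ha ti; rewrite intrM -scalerA -scalerBr memvZ.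
case: (asboolP (cone U t.1 = cone U [:: v p])) => [tp|ntp].
  rewrite asboolT; last first.
    rewrite tp -cone_swap; apply: ray_face => //.
    - exact: degree_rational.
    - exact: point_vec_lattice.
    - exact: std_vec_lattice.
    - by rewrite -dim2; apply/cone_dim_parallel/parallel_swap.
  by have [_ h] := hb tp; rewrite add0r intrM -scalerA -scalerBr memvZ.
rewrite asboolF ?addr0 ?scaler0 ?subr0 ?mem0v // => /(face_ray dimt dim2) [].
  exact: nti.
exact: ntp.
Qed.

(** * Fan axioms for nondegenerate arroids *)

Section Nondegenerate.
Hypothesis nondeg : nondegenerate_arroid A.

Lemma mem_point p : p \in underlying_points A -> (r <= #|p| < n)%N.
Proof. by move=> /imsetP[k _ ->]; have [_] := nondeg. Qed.

(** The difference is [c *: d] with [d] positive. It is nonpositive at [i], so [c <= 0], and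
    nonnegative at [j], so [c >= 0]. *)
Lemma degree_mod_inj (x y : 'rV[R]_n) i j :
  (forall k, 0 <= x 0 k) -> (forall k, 0 <= y 0 k) -> x 0 i = 0 -> y 0 j = 0 ->
  x - y \in U -> x = y.
Proof.
move=> x0 y0 xi yj /vlineP[c /rowP xy].
have dpos k : 0 < d 0 k by rewrite mxE ltr0n degree_gt0.
have xyE k : x 0 k - y 0 k = c * d 0 k by have := xy k; rewrite !mxE.
have c0 : c = 0.
  apply/eqP; rewrite eq_le -(pmulr_lle0 _ (dpos i)) -(pmulr_lge0 _ (dpos j)).
  by rewrite -!xyE xi yj sub0r subr0 oppr_le0 y0 x0.
by apply/rowP => k; apply/eqP; rewrite -subr_eq0 xyE c0 mul0r.
Qed.

Lemma std_vec_inj : injective e.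
Proof.
move=> i j /rowP/(_ i)/eqP; rewrite !std_vecE eqxx.
by case: (eqVneq j i) => // _; rewrite oner_eq0.
Qed.

Lemma point_vec_inj : injective v.
Proof.
move=> p q /rowP pq; apply/setP => j; have /eqP := pq j; rewrite !point_vecE eqr_nat.
by do 2 case: (j \in _).
Qed.

Lemma exists_other (p : {set 'I_n}) i : (1 < #|p|)%N -> exists2 j, j \in p & j != i.
Proof.
rewrite (cardsD1 i) => p2; have /card_gt0P[j] : (0 < #|p :\ i|)%N.
  by move: p2; case: (i \in p) => /=; [rewrite add1n ltnS|rewrite add0n; apply: ltnW].
by rewrite !inE => /andP[ji jp]; exists j.
Qed.

Lemma exists_notin (p : {set 'I_n}) : (#|p| < n)%N -> exists i, i \notin p.
Proof.
move=> pn; apply/existsP; apply: contraLR pn => /existsPn h.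
rewrite -leqNgt -[X in (X <= _)%N]card_ord; apply: subset_leq_card.
apply/fintype.subsetP => i _.
by have := h i; rewrite negbK.
Qed.

Lemma std_vec_neq_point i (p : {set 'I_n}) : (1 < #|p|)%N -> e i != v p.
Proof.
move=> /(exists_other i)[j jp ji]; apply/negP => /eqP/rowP h.
have /eqP := h j; rewrite std_vecE point_vecE jp [i == j]eq_sym (negPf ji).
by rewrite eq_sym oner_eq0.
Qed.

Lemma edge_vecE i p (a b : R) k :
  (a *: e i + b *: v p) 0 k = a * (i == k)%:R + b * (k \in p)%:R.
Proof. by rewrite mxE [X in X + _]mxE [X in _ + X]mxE std_vecE point_vecE. Qed.

(* [b] is the second largest coordinate of the vector [a *: e i + b *: v p]. *)
Lemma edge_vec_inj i j p q (a b a' b' : R) :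
  i \in p -> j \in q -> (1 < #|p|)%N -> (1 < #|q|)%N ->
  0 <= a -> 0 <= b -> 0 <= a' -> 0 <= b' ->
  a *: e i + b *: v p = a' *: e j + b' *: v q ->
  a = (if i == j then a' else 0) /\ b = (if p == q then b' else 0).
Proof.
move=> ip jq p2 q2 a0 b0 a'0 b'0 /rowP eqE.
have E k : a * (i == k)%:R + b * (k \in p)%:R = a' * (j == k)%:R + b' * (k \in q)%:R.
  by rewrite -!edge_vecE.
(* The set [q1] has an element [k] other than [i1]; coordinate [k] is at most [b1] on the left and
   at least [b2] on the right. *)
have second i1 j1 (p1 q1 : {set 'I_n}) (a1 b1 a2 b2 : R) : (1 < #|q1|)%N ->
    0 <= b1 -> 0 <= a2 ->
    (forall k, a1 * (i1 == k)%:R + b1 * (k \in p1)%:R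
               = a2 * (j1 == k)%:R + b2 * (k \in q1)%:R) -> b2 <= b1.
  move=> q12 b10 a20 E1; have [k kq ki] := exists_other i1 q12.
  have := E1 k; rewrite kq eq_sym (negPf ki) mulr0 add0r mulr1 => bE.
  apply: (@le_trans _ _ (b1 * (k \in p1)%:R)); last first.
    by case: (k \in p1); rewrite ?mulr1 ?mulr0.
  by rewrite bE lerDr mulr_ge0 // ler0n.
have bb' : b = b'.
  apply: le_anti; rewrite (second i j p q a b a' b') //.
  by rewrite (second j i q p a' b' a b).
have [b00|bn0] := eqVneq b 0.
  split; last by rewrite -bb' b00; case: ifP.
  have := E i; rewrite -bb' b00 !mul0r !addr0 eqxx mulr1 => ->.
  by rewrite eq_sym; case: eqP; rewrite ?mulr1 ?mulr0.
have bpos : 0 < b by rewrite lt0r bn0.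
(* A coordinate [k] in [p] but not in [q] differs from [j], so the right side vanishes there while
   the left side is at least [b > 0]; the other case is symmetric. *)
have pq : p = q.
  apply/setP => k; have := E k; rewrite -bb'.
  have ge0 (z : R) (t : bool) : 0 <= z -> 0 <= z * t%:R.
    by move=> z0; rewrite mulr_ge0 // ler0n.
  case kp : (k \in p); case kq : (k \in q) => //; rewrite mulr1 mulr0 addr0.
    have -> : (j == k) = false by apply: contraFF kq => /eqP <-.
    by rewrite mulr0; have := ge0 _ (i == k) a0; lra.
  have -> : (i == k) = false by apply: contraFF kp => /eqP <-.
  by rewrite mulr0; have := ge0 _ (j == k) a'0; lra.
split; last by rewrite pq eqxx.
have := E i; rewrite -bb' -pq ip eqxx mulr1 => /addIr ->.
by rewrite eq_sym; case: eqP; rewrite ?mulr1 ?mulr0.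
Qed.

(** Points are nonempty and proper, so [degree_mod_inj] turns the congruence into an equality, and a
    nonzero multiple of [v p] determines [p] as its support. *)
Lemma separated_rank1 p q : r = 1%N ->
  p \in underlying_points A -> q \in underlying_points A ->
  separated U [:: v p] [:: v q].
Proof.
move=> r1 /mem_point/andP[p1 pn] /mem_point/andP[q1 qn] c c' c0 c'0.
have [[i ip] [j jq]] := (exists_notin pn, exists_notin qn).
have vE (a : R) (s : {set 'I_n}) k : (a *: v s) 0 k = a * (k \in s)%:R.
  by rewrite mxE point_vecE.
rewrite !big_seq1 => /(degree_mod_inj (i := i) (j := j)) h _ /[!inE] /eqP->.
have /rowP{}h : c (v p) *: v p = c' (v q) *: v q.
  apply: h => [k|k||]; rewrite vE ?mulr_ge0 //.
    by rewrite (negPf ip) mulr0.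
  by rewrite (negPf jq) mulr0.
have [k kp] : exists k, k \in p by apply/card_gt0P; rewrite -r1.
case: eqP => [pq|npq]; first by have := h k; rewrite -pq !vE kp !mulr1.
apply/eqP/negPn/negP => cn0; apply: npq; congr v.
have := h k; rewrite !vE kp mulr1 => ck.
have c'n0 : c' (v q) != 0 by apply: contraNneq cn0 => c'0'; rewrite ck c'0' mul0r.
apply/setP => l; have /eqP := h l; rewrite !vE.
by case: (l \in p); case: (l \in q);
  rewrite ?mulr1 ?mulr0 // ?(negPf cn0) 1?eq_sym ?(negPf c'n0).
Qed.

(** A coordinate outside [p] vanishes on [e i] too, because [i] is in [p]. So [degree_mod_inj]
    applies, and [edge_vec_inj] compares the coefficients. *)
Lemma separated_rank2 i p j q : r = 2%N ->
  p \in underlying_points A -> q \in underlying_points A ->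
  i \in p -> j \in q -> separated U [:: e i; v p] [:: e j; v q].
Proof.
move=> r2 /mem_point/andP[p2 pn] /mem_point/andP[q2 qn] ip jq c c' c0 c'0.
have [{}p2 {}q2] : (1 < #|p|)%N /\ (1 < #|q|)%N by rewrite -r2.
have [[k kp] [l lq]] := (exists_notin pn, exists_notin qn).
rewrite !big_cons !big_nil !addr0 => /(degree_mod_inj (i := k) (j := l)) h.
have ge0 (z : R) (t : bool) : 0 <= z -> 0 <= z * t%:R.
  by move=> z0; rewrite mulr_ge0 // ler0n.
have {}h : c (e i) *: e i + c (v p) *: v p = c' (e j) *: e j + c' (v q) *: v q.
  apply: h => [m|m||]; rewrite edge_vecE ?addr_ge0 ?ge0 //.
    rewrite (negPf kp); case: eqP kp => [<-|_ _]; first by rewrite ip.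
    by rewrite !mulr0 addr0.
  rewrite (negPf lq); case: eqP lq => [<-|_ _]; first by rewrite jq.
  by rewrite !mulr0 addr0.
have [] := edge_vec_inj ip jq p2 q2 _ _ _ _ h => // ha hb.
move=> b; rewrite !inE => /orP[]/eqP->.
- rewrite (negPf (std_vec_neq_point _ q2)) orbF (inj_eq std_vec_inj) ha.
  by case: eqP => // ->.
- rewrite eq_sym (negPf (std_vec_neq_point _ p2)) /= (inj_eq point_vec_inj) hb.
  by case: eqP => // ->.
Qed.

Lemma pure_rank1 : r = 1%N -> pure_rational_fan r F.
Proof.
move=> r1; have cF := cones_rank1 r1.
have nilF : ([::], 0) \in cones F by rewrite cF mem_head.
have rayF p : p \in underlying_points A -> ([:: v p], weight p [:: v p]) \in cones F.
  move=> pA; rewrite cF inE; apply/orP; right; apply/mapP.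
  by exists p; rewrite ?mem_enum.
have memF s : s \in cones F -> s = ([::], 0) \/
    exists2 p, p \in underlying_points A & s = ([:: v p], weight p [:: v p]).
  rewrite cF inE => /predU1P[->|/mapP[p + ->]]; [by left|rewrite mem_enum => pA].
  by right; exists p.
(* Purity requires the origin to be a face of some ray; there is one because the point vectors sum
   to [d], which is nonzero. *)
have [p0 p0A] : exists p, p \in underlying_points A.
  have n0 : (0 < n)%N by have [] := nondeg; lia.
  have : d != 0.
    apply/eqP => /rowP/(_ (Ordinal n0))/eqP.
    by rewrite !mxE pnatr_eq0 eqn0Ngt degree_gt0.
  rewrite -sum_point_vec1 //; have [k _ _|noA] := pickP 'I_(npoints A).
    by exists (point k); apply/imsetP; exists k.
  by rewrite big_pred0 ?eqxx // => k; have := noA k.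
have maxF s : s \in cones F -> exists2 p, p \in underlying_points A &
    exists P : pred 'rV[R]_n, s.1 = filter P [:: v p].
  move=> /memF[->|[p pA ->]]; first by exists p0 => //; exists pred0.
  by exists p => //; exists predT.
apply: simplicial_fan.
- exact: degree_rational.
- move=> s /memF[->|[p _ ->]] //; split=> // x; rewrite inE => /eqP->.
  exact: point_vec_lattice.
- move=> s t /maxF[p pA [P ->]] /maxF[q qA [Q ->]].
  by apply: separated_filter; apply: separated_rank1.
- move=> s t /memF[->|[p _ ->]] /memF[->|[q _ ->]] //= st.
  + by have := st (v q); rewrite !inE eqxx.
  + by have := st (v p); rewrite !inE eqxx.
  + by have := st (v p); rewrite !inE eqxx => /esym/eqP/point_vec_inj ->.
- move=> s + P => /memF[->|[p pA ->]] /=; first by exists ([::], 0).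
  case: (P _); last by exists ([::], 0).
  by exists ([:: v p], weight p [:: v p]) => //; exact: rayF.
- move=> s /maxF[p pA [P sE]]; exists ([:: v p], weight p [:: v p]).
    by split; [exact: rayF|rewrite r1].
  by exists P.
- rewrite cF /=; apply/andP; split; first by apply/mapP => -[].
  by rewrite map_inj_uniq ?enum_uniq // => p q [/point_vec_inj].
- by rewrite cF.
Qed.

Lemma pure_rank2 : r = 2%N -> pure_rational_fan r F.
Proof.
move=> r2; have cF := cones_rank2 r2.
have card_gt1 p : p \in underlying_points A -> (1 < #|p|)%N.
  by move=> /mem_point; rewrite {1}r2 => /andP[].
have nilF : ([::], 0) \in cones F by rewrite cF mem_head.
have eF i : ([:: e i], 0) \in cones F.
  by rewrite cF inE !mem_cat (map_f (fun i => ([:: e i], 0%Z))) ?mem_enum ?orbT.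
have vF p : p \in underlying_points A -> ([:: v p], 0) \in cones F.
  move=> pA; rewrite cF inE !mem_cat (map_f (fun p => ([:: v p], 0%Z))) ?orbT //.
  by rewrite mem_enum.
have edgeF p i : p \in underlying_points A -> i \in p ->
    ([:: e i; v p], weight p [:: e i; v p]) \in cones F.
  move=> pA ip; rewrite cF inE !mem_cat; apply/or4P/Or44/allpairsPdep.
  by exists p, i; rewrite !mem_enum.
have memF s : s \in cones F -> [\/ s = ([::], 0), exists i, s = ([:: e i], 0),
    exists2 p, p \in underlying_points A & s = ([:: v p], 0)
    | exists p i, [/\ p \in underlying_points A, i \in p
        & s = ([:: e i; v p], weight p [:: e i; v p])]].
  rewrite cF inE !mem_cat => /or4P[/eqP->|/mapP[i _ ->]|/mapP[p + ->]|].
  - by apply: Or41.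
  - by apply: Or42; exists i.
  - by rewrite mem_enum => pA; apply: Or43; exists p.
  - move=> /allpairsPdep[p [i []]]; rewrite !mem_enum => pA ip ->.
    by apply: Or44; exists p, i.
(* With a second divisor [j], the Bezout property yields [d_j d_i > 0] points through both; hence
   each ray of a divisor lies in a two-dimensional cone. *)
have through i : exists2 p, p \in underlying_points A & i \in p.
  have gt1 : (1 < #|[set: 'I_n]%SET|)%N.
    by rewrite cardsT card_ord; have [] := nondeg; lia.
  have [j _ ji] := exists_other i gt1.
  have := card_points2 r2 ji; set K := [pred k | _] => cardK.
  have /card_gt0P[k] : (0 < #|K|)%N by rewrite cardK muln_gt0 !degree_gt0.
  by rewrite inE => /andP[_ ik]; exists (point k) => //; apply/imsetP; exists k.
have maxF s : s \in cones F -> exists p i, [/\ p \in underlying_points A, i \in p &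
    exists P : pred 'rV[R]_n, s.1 = filter P [:: e i; v p]].
  have n0 : (0 < n)%N by have [] := nondeg; lia.
  move=> /memF[->|[i ->]|[p pA ->]|[p [i [pA ip ->]]]].
  - have [p pA ip] := through (Ordinal n0).
    by exists p, (Ordinal n0); split=> //; exists pred0.
  - have [p pA ip] := through i; exists p, i; split=> //; exists (pred1 (e i)).
    by rewrite /= eqxx eq_sym (negPf (std_vec_neq_point i (card_gt1 _ pA))).
  - have /card_gt0P[i ip] : (0 < #|p|)%N by apply: ltnW; apply: card_gt1.
    exists p, i; split=> //; exists (pred1 (v p)).
    by rewrite /= eqxx (negPf (std_vec_neq_point i (card_gt1 _ pA))).
  - by exists p, i; split=> //; exists predT.
have gens s : s \in cones F -> uniq s.1 /\ {subset s.1 <= @lattice R n}.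
  move=> sF; have [p [i [pA ip [P ->]]]] := maxF s sF; split.
    apply: filter_uniq; rewrite /= inE andbT.
    exact/std_vec_neq_point/card_gt1.
  move=> x; rewrite mem_filter !inE => /andP[_ /orP[]/eqP->].
    exact: std_vec_lattice.
  exact: point_vec_lattice.
apply: simplicial_fan => //.
- exact: degree_rational.
- move=> s t /maxF[p [i [pA ip [P ->]]]] /maxF[q [j [qA jq [Q ->]]]].
  by apply: separated_filter; apply: separated_rank2.
- move=> s t sF tF st.
  (* Comparing sizes discards most of the sixteen pairs of cone types. *)
  have : size s.1 = size t.1.
    apply: perm_size; apply: uniq_perm st; first by have [] := gens _ sF.
    by have [] := gens _ tF.
  have ev i p : p \in underlying_points A -> (e i == v p) = false.
    by move=> /card_gt1/(std_vec_neq_point i)/negPf.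
  move: sF tF st => /memF[->|[i ->]|[p pA ->]|[p [i [pA ip ->]]]]
    /memF[->|[j ->]|[q qA ->]|[q [j [qA jq ->]]]] //= st _.
  + by have := st (e i); rewrite !inE eqxx => /esym/eqP/std_vec_inj->.
  + by have := st (e i); rewrite !inE eqxx ev.
  + by have := st (v p); rewrite !inE eqxx eq_sym ev.
  + by have := st (v p); rewrite !inE eqxx => /esym/eqP/point_vec_inj->.
  + have := st (e i); rewrite !inE eqxx !ev //= orbF => /esym/eqP/std_vec_inj <-.
    have := st (v p); rewrite !inE eqxx orbT [_ == e _]eq_sym ev //=.
    by move=> /esym/eqP/point_vec_inj <-.
- move=> s + P => /memF[->|[i ->]|[p pA ->]|[p [i [pA ip ->]]]] /=.
  + by exists ([::], 0).
  + by case: (P _); [exists ([:: e i], 0)|exists ([::], 0)].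
  + by case: (P _); [exists ([:: v p], 0); rewrite ?vF|exists ([::], 0)].
  + case: (P _); case: (P _).
    * by exists ([:: e i; v p], weight p [:: e i; v p]) => //; exact: edgeF.
    * by exists ([:: e i], 0).
    * by exists ([:: v p], 0); rewrite ?vF.
    * by exists ([::], 0).
- move=> s /maxF[p [i [pA ip [P sE]]]].
  exists ([:: e i; v p], weight p [:: e i; v p]); last by exists P.
  by split; [exact: edgeF|rewrite r2].
- rewrite cF; rewrite cons_uniq !cat_uniq; apply/and5P; split.
  + rewrite !mem_cat; apply/or3P => -[/mapP[]|/mapP[]|/allpairsPdep[? [? []]]] //.
  + by rewrite map_inj_uniq ?enum_uniq // => i j [/std_vec_inj].
  + apply/hasPn => s; rewrite mem_cat => /orP[/mapP[p + ->]|].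
      rewrite mem_enum => pA; apply/mapP => -[i _ [/eqP]].
      by rewrite eq_sym (negPf (std_vec_neq_point i (card_gt1 _ pA))).
    by move=> /allpairsPdep[p [i [_ _ ->]]]; apply/mapP => -[].
  + by rewrite map_inj_uniq ?enum_uniq // => p q [/point_vec_inj].
  + apply/andP; split.
      by apply/hasPn => s /allpairsPdep[p [i [_ _ ->]]]; apply/mapP => -[].
    apply: allpairs_uniq_dep => [|p _|[p i] [q j] _ _ /= []]; rewrite ?enum_uniq //.
    by move=> /std_vec_inj <- /point_vec_inj <-.
- by rewrite cF.
Qed.

Lemma arroid_tropical_variety : tropical_variety r F.
Proof.
have [r1|r2] := arroid_rank; split.
- exact: pure_rank1.
- exact: balanced_rank1.
- exact: pure_rank2.
- exact: balanced_rank2.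
Qed.

(** Unimodularity only speaks of cones of dimension [r]; the other cones have weight zero, which the
    index factor leaves unchanged. *)
Lemma weight_neq0_cone_dim s : s \in cones (arroid_fan R A) ->
  s.2 = 0 \/ cone_dim U s.1 = r.
Proof.
have [r1|r2] := arroid_rank.
  rewrite /= [X in X == 1%N]r1 /= inE => /predU1P[->|/mapP[p + ->]]; first by left.
  rewrite mem_enum => pA; right; rewrite free_cone_dim ?r1 //.
  by apply: separated_free; apply: separated_rank1.
rewrite /= [X in X == 1%N]r2 /= inE !mem_cat.
move=> /or4P[/eqP->|/mapP[i _ ->]|/mapP[p _ ->]|]; [by left|by left|by left|].
move=> /allpairsPdep[p [i []]]; rewrite !mem_enum => pA ip -> /=; right.
have [p2 _] := andP (mem_point pA); rewrite free_cone_dim //.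
- by rewrite /= inE andbT; apply: std_vec_neq_point; rewrite -r2.
- by apply: separated_free; apply: separated_rank2.
Qed.

Lemma unimodular_index_weighted :
  unimodular r (arroid_fan R A) -> index_weighted (arroid_fan R A) = arroid_fan R A.
Proof.
move=> unim; rewrite /index_weighted.
suff /map_id_in -> : {in cones (arroid_fan R A), forall s,
    (s.1, s.2 * (lattice_index (modulus (arroid_fan R A)) s.1)%:Z) = s} by [].
move=> [s w] sF; have [/= ->|/= dims] := weight_neq0_cone_dim sF.
  by rewrite mul0r.
by rewrite (lattice_index1 (unim _ sF dims)) mulr1.
Qed.

End Nondegenerate.
End Arroid.

Theorem theorem4p10 (R : realType) (r n : nat) (A : arroid r n) :
  transversal_arroid A ->
  balanced r (index_weighted (arroid_fan R A)) /\
  (nondegenerate_arroid A ->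
     tropical_variety r (index_weighted (arroid_fan R A)) /\
     (unimodular r (arroid_fan R A) -> tropical_variety r (arroid_fan R A))).
Proof.
move=> transversal; split.
  by have [r1|r2] := arroid_rank A; [apply: balanced_rank1|apply: balanced_rank2].
move=> nondeg; have trop := arroid_tropical_variety (R := R) transversal nondeg.
by split=> // /(unimodular_index_weighted nondeg) <-.
Qed.
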